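(* Let $\epsilon\in(0,1)$ be a given error tolerance. Assume: (1) there exists an optimal solution $(x^*,y^*,z^* )$ of the primal-dual pair (P)-(D) with $\|x^*\|_\infty\le C^*$, $\|y^*\|_\infty\le C^*$, $\|z^*\|_\infty\le C^*$ for some constant $C^*\ge 0$ independent of $n$ and $m$; (2) $\operatorname{rank}(A)=m$, and there exist constants $C_A^1>0$, $C_A^2>0$, $C_Q>0$, $C_r>0$, independent of $n$ and $m$, such that $\eta_{\min}(A)\ge C_A^1$, $\eta_{\max}(A)\le C_A^2$, $\nu_{\max}(Q)\le C_Q$ and $\|(c,b)\|_\infty\le C_r$. Choose the starting point of Algorithm IP-PMM as described in the context, such that $\mu_0\le \frac{C}{\epsilon^{\omega}}$ for some positive constants $C,\omega$. Then there exists an index $K$ with $$K=O\Big(n^4\,\Big|\log\Big(\frac1\epsilon\Big)\Big|\Big)$$ such that the iterates $w_k=(x_k^T,y_k^T,z_k^T)^T$ generated by Algorithm IP-PMM satisfy $$\mu_k\le\epsilon\quad\text{for all } k\ge K .$$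
   Context: Problem. $A\in\mathbb{R}^{m\times n}$ with $m\le n$, $Q\in\mathbb{R}^{n\times n}$ is symmetric positive semi-definite, $b\in\mathbb{R}^m$, $c\in\mathbb{R}^n$. The primal-dual pair is (P) $\min_x\ c^Tx+\frac12x^TQx$ s.t. $Ax=b$, $x\ge0$; (D) $\max_{x,y,z}\ b^Ty-\frac12x^TQx$ s.t. $-Qx+A^Ty+z=c$, $z\ge0$. Notation. Superscripts denote components; $e_n$ is the all-ones vector; $X,Z$ (resp. $X_k,Z_k$) are the diagonal matrices with diagonals $x,z$ (resp. $x_k,z_k$). $\eta_{\min},\eta_{\max}$ are minimum/maximum singular values and $\nu_{\max}$ the maximum eigenvalue. $O(f(n))$ denotes a quantity bounded above by a constant times $f(n)$ (for $n$ large), the constant being independent of $n$ and $m$ (and of the iteration index $k$). Semi-norm. For $b'\in\mathbb{R}^m,\ c'\in\mathbb{R}^n$: $\|(b',c')\|_{\mathcal A}:=\min_{x,y,z}\{\|(x,z)\|_2: Ax=b',\ -Qx+A^Ty+z=c'\}$. Starting point. $(x_0,z_0)=\rho(e_n,e_n)$ for some constant $\rho>0$; $y_0$ is any vector with $\|y_0\|_\infty=O(1)$; $\mu_0=x_0^Tz_0/n$; $\bar b:=Ax_0-b$, $\bar c:=-Qx_0+A^Ty_0+z_0-c$; $\zeta_0=x_0$, $\lambda_0=y_0$. Neighbourhood. Fix constants $C_N>0$, $\gamma_{\mathcal A},\gamma_\mu\in(0,1)$. For $\mu>0$, $\zeta\in\mathbb{R}^n$, $\lambda\in\mathbb{R}^m$,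 $\mathcal N_\mu(\zeta,\lambda)$ is the set of $(x,y,z)$ with $(x,z)>(0,0)$, $x^iz^i\ge\gamma_\mu\mu$ for all $i\in\{1,\dots,n\}$, and such that for some $\tilde b\in\mathbb{R}^m,\tilde c\in\mathbb{R}^n$ with $\|(\tilde b,\tilde c)\|_2\le C_N$, $\|(\tilde b,\tilde c)\|_{\mathcal A}\le\gamma_{\mathcal A}\rho$: $Ax+\mu(y-\lambda)=b+\frac{\mu}{\mu_0}(\bar b+\tilde b)$, $\ -Qx+A^Ty+z-\mu(x-\zeta)=c+\frac{\mu}{\mu_0}(\bar c+\tilde c)$. Algorithm IP-PMM. Parameters $0<\sigma_{\min}\le\sigma_{\max}\le0.5$, the constants $C_N>0$ and $\gamma_{\mathcal A},\gamma_\mu\in(0,1)$ used to define the neighbourhood $\mathcal N_\mu(\zeta,\lambda)$, and a tolerance $\mathrm{tol}$. For $k=0,1,2,\dots$: if $\|Ax_k-b\|_2<\mathrm{tol}$, $\|c+Qx_k-A^Ty_k-z_k\|_2<\mathrm{tol}$ and $\mu_k<\mathrm{tol}$, return $(x_k,y_k,z_k)$. (Statements about infinite sequences of iterates refer to the iteration continued without this stopping test.) Otherwise: (a) choose $\sigma_k\in[\sigma_{\min},\sigma_{\max}]$ and compute the Newton direction $(\Delta x_k,\Delta y_k,\Delta z_k)$ from $-(Q+\mu_kI_n)\Delta x_k+A^T\Delta y_k+\Delta z_k=(c+\frac{\sigma_k\mu_k}{\mu_0}\bar c)+Qx_k-A^Ty_k-z_k+\sigma_k\mu_k(x_k-\zeta_k)$,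 $A\Delta x_k+\mu_k\Delta y_k=(b+\frac{\sigma_k\mu_k}{\mu_0}\bar b)-Ax_k-\sigma_k\mu_k(y_k-\lambda_k)$, $Z_k\Delta x_k+X_k\Delta z_k=-X_kZ_ke_n+\sigma_k\mu_ke_n$; (b) let $\alpha_k$ be the largest $\alpha\in(0,1]$ such that $\mu_k(\alpha)\le(1-0.01\alpha)\mu_k$ and $(x_k+\alpha\Delta x_k,y_k+\alpha\Delta y_k,z_k+\alpha\Delta z_k)\in\mathcal N_{\mu_k(\alpha)}(\zeta_k,\lambda_k)$, where $\mu_k(\alpha)=\frac{(x_k+\alpha\Delta x_k)^T(z_k+\alpha\Delta z_k)}{n}$; (c) set $(x_{k+1},y_{k+1},z_{k+1})=(x_k,y_k,z_k)+\alpha_k(\Delta x_k,\Delta y_k,\Delta z_k)$, $\mu_{k+1}=x_{k+1}^Tz_{k+1}/n$; (d) let $r_p=Ax_{k+1}-(b+\frac{\mu_{k+1}}{\mu_0}\bar b)$, $r_d=-Qx_{k+1}+A^Ty_{k+1}+z_{k+1}-(c+\frac{\mu_{k+1}}{\mu_0}\bar c)$. If $\|(r_p,r_d)\|_2\le C_N\frac{\mu_{k+1}}{\mu_0}$ and $\|(r_p,r_d)\|_{\mathcal A}\le\gamma_{\mathcal A}\rho\frac{\mu_{k+1}}{\mu_0}$, set $(\zeta_{k+1},\lambda_{k+1})=(x_{k+1},y_{k+1})$; otherwise $(\zeta_{k+1},\lambda_{k+1})=(\zeta_k,\lambda_k)$. *)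

(* Defs.v *)
From HB Require Import structures.
From mathcomp Require Import all_boot all_order all_algebra.
From mathcomp Require Import all_classical all_reals all_analysis.

Set Implicit Arguments.
Unset Strict Implicit.
Unset Printing Implicit Defensive.

Import Order.TTheory GRing.Theory Num.Theory.
Import numFieldNormedType.Exports.

Local Open Scope classical_set_scope.
Local Open Scope ring_scope.

(* Vectors are columns.  The norm [`|x|] that the library puts on matrices is
   the maximum of the absolute values of the entries, i.e. the infinity-norm
   on column vectors; the Euclidean norm is [norm2].  A pair of vectors (u, v)
   is stacked as [col_mx u v]. *)

Definition dot (R : realType) (n : nat) (u v : 'cV[R]_n) : R :=
  \sum_i u i 0 * v i 0.

Definition norm2 (R : realType) (n : nat) (u : 'cV[R]_n) : R :=
  Num.sqrt (dot u u).

(* The singular values of a matrix with m <= n are the square roots of the m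
   eigenvalues of A A^T, the zero ones included.  There are finitely many, and
   at least one if m > 0, so [inf] and [sup] below are a minimum and a
   maximum. *)
Definition singular_values (R : realType) (m n : nat) (A : 'M[R]_(m, n)) :
    set R :=
  [set s | 0 <= s /\ eigenvalue (A *m A^T) (s ^+ 2)].

Definition eta_min (R : realType) (m n : nat) (A : 'M[R]_(m, n)) : R :=
  inf (singular_values A).

Definition eta_max (R : realType) (m n : nat) (A : 'M[R]_(m, n)) : R :=
  sup (singular_values A).

Definition nu_max (R : realType) (n : nat) (Q : 'M[R]_n) : R :=
  sup [set a | eigenvalue Q a].

Definition sym_psd (R : realType) (n : nat) (Q : 'M[R]_n) : Prop :=
  Q^T = Q /\ forall x : 'cV[R]_n, 0 <= dot x (Q *m x).

Record qp (R : realType) (m n : nat) := QP {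
  qpA : 'M[R]_(m, n);
  qpQ : 'M[R]_n;
  qpb : 'cV[R]_m;
  qpc : 'cV[R]_n
}.

Section PrimalDual.
Context {R : realType} {m n : nat} (P : qp R m n).
Local Notation A := (qpA P).
Local Notation Q := (qpQ P).
Local Notation b := (qpb P).
Local Notation c := (qpc P).

Definition primal_obj (x : 'cV[R]_n) : R := dot c x + 2^-1 * dot x (Q *m x).

Definition primal_feasible (x : 'cV[R]_n) : Prop :=
  A *m x = b /\ forall i, 0 <= x i 0.

Definition dual_obj (x : 'cV[R]_n) (y : 'cV[R]_m) : R :=
  dot b y - 2^-1 * dot x (Q *m x).

(* x is not sign-constrained in the dual. *)
Definition dual_feasible (x : 'cV[R]_n) (y : 'cV[R]_m) (z : 'cV[R]_n) : Prop :=
  - (Q *m x) + A^T *m y + z = c /\ forall i, 0 <= z i 0.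

Definition optimal_solution (x : 'cV[R]_n) (y : 'cV[R]_m) (z : 'cV[R]_n) :
    Prop :=
  [/\ primal_feasible x,
      forall x', primal_feasible x' -> primal_obj x <= primal_obj x',
      dual_feasible x y z &
      forall x' y' z', dual_feasible x' y' z' ->
        dual_obj x' y' <= dual_obj x y].

(* The minimum is attained as soon as the constraints are feasible, which is
   always the case if A has full row rank. *)
Definition seminorm (b' : 'cV[R]_m) (c' : 'cV[R]_n) : R :=
  inf [set t | exists x y z,
    [/\ A *m x = b', - (Q *m x) + A^T *m y + z = c' & t = norm2 (col_mx x z)]].

End PrimalDual.

Record parameters (R : realType) := Params {
  rho : R;
  C_N : R;
  gamma_A : R;
  gamma_mu : R;
  sigma_min : R;
  sigma_max : R
}.

Definition valid_parameters (R : realType) (par : parameters R) : Prop :=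
  [/\ 0 < rho par,
      0 < C_N par,
      0 < gamma_A par < 1,
      0 < gamma_mu par < 1 &
      [/\ 0 < sigma_min par, sigma_min par <= sigma_max par &
          sigma_max par <= 2^-1]].

Record iterate (R : realType) (m n : nat) := Iterate {
  it_x : 'cV[R]_n;
  it_y : 'cV[R]_m;
  it_z : 'cV[R]_n;
  it_zeta : 'cV[R]_n;
  it_lambda : 'cV[R]_m
}.

Definition mu_of (R : realType) (n : nat) (x z : 'cV[R]_n) : R :=
  dot x z / n%:R.

Definition mu (R : realType) (m n : nat) (w : iterate R m n) : R :=
  mu_of (it_x w) (it_z w).

Section Algorithm.
Context {R : realType} {m n : nat} (par : parameters R) (P : qp R m n)
  (y0 : 'cV[R]_m).
Local Notation A := (qpA P).
Local Notation Q := (qpQ P).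
Local Notation b := (qpb P).
Local Notation c := (qpc P).

Definition start : iterate R m n :=
  let v := const_mx (rho par) in Iterate v y0 v v y0.

Definition mu0 : R := mu start.

Definition bbar : 'cV[R]_m := A *m it_x start - b.

Definition cbar : 'cV[R]_n :=
  - (Q *m it_x start) + A^T *m it_y start + it_z start - c.

Definition neighbourhood (mu : R) (zeta : 'cV[R]_n) (lambda : 'cV[R]_m)
    (x : 'cV[R]_n) (y : 'cV[R]_m) (z : 'cV[R]_n) : Prop :=
  [/\ forall i, 0 < x i 0,
      forall i, 0 < z i 0,
      forall i, gamma_mu par * mu <= x i 0 * z i 0 &
      exists (bt : 'cV[R]_m) (ct : 'cV[R]_n),
        [/\ norm2 (col_mx bt ct) <= C_N par,
            seminorm P bt ct <= gamma_A par * rho par,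
            A *m x + mu *: (y - lambda) = b + (mu / mu0) *: (bbar + bt) &
            - (Q *m x) + A^T *m y + z - mu *: (x - zeta)
              = c + (mu / mu0) *: (cbar + ct)]].

Definition newton_direction (w : iterate R m n) (sigma : R)
    (dx : 'cV[R]_n) (dy : 'cV[R]_m) (dz : 'cV[R]_n) : Prop :=
  let: Iterate x y z zeta lambda := w in
  [/\ - ((Q + (mu w)%:M) *m dx) + A^T *m dy + dz
        = (c + (sigma * mu w / mu0) *: cbar) + Q *m x - A^T *m y - z
          + (sigma * mu w) *: (x - zeta),
      A *m dx + mu w *: dy
        = (b + (sigma * mu w / mu0) *: bbar) - A *m x
          - (sigma * mu w) *: (y - lambda) &
      diag_mx z^T *m dx + diag_mx x^T *m dz
        = - (diag_mx x^T *m diag_mx z^T *m const_mx 1)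
          + (sigma * mu w) *: const_mx 1].

Definition admissible_step (w : iterate R m n)
    (dx : 'cV[R]_n) (dy : 'cV[R]_m) (dz : 'cV[R]_n) (alpha : R) : Prop :=
  let x := it_x w + alpha *: dx in
  let y := it_y w + alpha *: dy in
  let z := it_z w + alpha *: dz in
  [/\ 0 < alpha <= 1,
      mu_of x z <= (1 - alpha / 100) * mu w &
      neighbourhood (mu_of x z) (it_zeta w) (it_lambda w) x y z].

Definition step_length (w : iterate R m n)
    (dx : 'cV[R]_n) (dy : 'cV[R]_m) (dz : 'cV[R]_n) (alpha : R) : Prop :=
  admissible_step w dx dy dz alpha /\
  forall alpha', admissible_step w dx dy dz alpha' -> alpha' <= alpha.

(* The test that decides whether the proximal estimates are updated. *)
Definition update_test (x : 'cV[R]_n) (y : 'cV[R]_m) (z : 'cV[R]_n) : Prop :=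
  let mu' := mu_of x z in
  let rp := A *m x - (b + (mu' / mu0) *: bbar) in
  let rd := - (Q *m x) + A^T *m y + z - (c + (mu' / mu0) *: cbar) in
  norm2 (col_mx rp rd) <= C_N par * (mu' / mu0) /\
  seminorm P rp rd <= gamma_A par * rho par * (mu' / mu0).

Definition ippmm_step (w w' : iterate R m n) : Prop :=
  exists (sigma : R) (dx : 'cV[R]_n) (dy : 'cV[R]_m) (dz : 'cV[R]_n)
    (alpha : R),
  [/\ sigma_min par <= sigma <= sigma_max par,
      newton_direction w sigma dx dy dz,
      step_length w dx dy dz alpha,
      [/\ it_x w' = it_x w + alpha *: dx,
          it_y w' = it_y w + alpha *: dy &
          it_z w' = it_z w + alpha *: dz] &
      (update_test (it_x w') (it_y w') (it_z w') ->
         it_zeta w' = it_x w' /\ it_lambda w' = it_y w') /\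
      (~ update_test (it_x w') (it_y w') (it_z w') ->
         it_zeta w' = it_zeta w /\ it_lambda w' = it_lambda w)].

(* The iteration continued without the stopping test, so that the tolerance
   plays no role. *)
Definition ippmm_run (w : nat -> iterate R m n) : Prop :=
  w 0%N = start /\ forall k, ippmm_step (w k) (w k.+1).

End Algorithm.

(* Main.v *)
Require Import Defs.
From mathcomp Require Import all_boot all_order all_algebra.
From mathcomp Require Import all_classical all_reals all_analysis.
From mathcomp Require Import ring lra.

(** Everything rests on one monotonicity inequality.  If [A x = - mu u] and
    [z = Q x - A^T y + mu v], then [x.z >= mu (y.u + x.v)], because [Q] is
    positive semi-definite and the cross terms cancel.

    With [t = mu / mu0], subtract from an iterate the combination
    [t (starting point + preimage of the perturbation) + (1 - t) (xs, ys, zs)],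
    where [(xs, ys, zs)] is the optimal solution.
    The difference satisfies such a system with [u = y - lambda] and
    [v = x - zeta].  The preimage given by the semi-norm has entries at most
    [(1 - gap) rho], so the first term of the combination has entries at least
    [t gap rho], and [xs.zs = 0] by strong duality; expanding the inequality
    then bounds [|x|_1 + |z|_1].  The proximal points are iterates that also
    lie in the neighbourhood centred at themselves, for which the proximal
    terms vanish: they are O(n).  The inequality for the other iterates gives
    [|x - zeta|, |y - lambda| = O(n)] and [|x|_1, |z|_1 = O(n^2)].

    Applied to the Newton direction, shifted to remove the residuals, the same
    inequality gives [|D^-1 dx|, |D dz| = O(n^2 mu^(1/2))] with [D^2 = X Z^-1],
    and [|dx|, |dy| = O(n^2)].  The error made by a step [alpha] on mu and on
    the residuals is of order [alpha^2 n^4 mu], against a gain of order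
    [alpha sigma mu], so that the step [kappa / n^4] is admissible.  Hence mu
    decreases by a factor [1 - kappa / (100 n^4)] at least. *)

Set Implicit Arguments.
Unset Strict Implicit.
Unset Printing Implicit Defensive.

Import Order.TTheory GRing.Theory Num.Theory.
Import numFieldNormedType.Exports.

Local Open Scope ring_scope.

(** * Elementary inequalities and inner products *)

Lemma discriminant_le (R : realType) (a b c : R) :
  0 <= c -> (forall s, 0 <= a - 2 * s * b + s ^+ 2 * c) -> b ^+ 2 <= a * c.
Proof.
rewrite le_eqVlt => /orP[/eqP <-|c0] h.
  have [->|b0] := eqVneq b 0; first by rewrite expr0n /= mulr0.
  (* When [c = 0] the expression is affine in [s]; at this value of [s] it equals -1. *)
  have := h ((a + 1) / (2 * b)).
  have -> : 2 * ((a + 1) / (2 * b)) * b = a + 1 by field.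
  by lra.
have := h (b / c).
have -> : a - 2 * (b / c) * b + (b / c) ^+ 2 * c = (a * c - b ^+ 2) / c.
  by field; rewrite gt_eqF.
by rewrite pmulr_lge0 ?invr_gt0// subr_ge0.
Qed.

Lemma sqr_le_pos (R : realType) (a b : R) : 0 <= b -> a ^+ 2 <= b ^+ 2 -> a <= b.
Proof.
move=> b0 ab; rewrite leNgt; apply/negP => ba.
by have := ltrXn2r 2 b0 ba; rewrite ltNge ab.
Qed.

Section InnerProduct.
Context {R : realType}.
Implicit Types (m n : nat).

Lemma dotE n (u v : 'cV[R]_n) : dot u v = (u^T *m v) 0 0.
Proof. by rewrite mxE; apply: eq_bigr => i _; rewrite mxE. Qed.

Lemma dotC n (u v : 'cV[R]_n) : dot u v = dot v u.
Proof. by apply: eq_bigr => i _; rewrite mulrC. Qed.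

Lemma dotDl n (u v w : 'cV[R]_n) : dot (u + v) w = dot u w + dot v w.
Proof. by rewrite -big_split; apply: eq_bigr => i _; rewrite mxE mulrDl. Qed.

Lemma dotZl n a (u v : 'cV[R]_n) : dot (a *: u) v = a * dot u v.
Proof. by rewrite mulr_sumr; apply: eq_bigr => i _; rewrite mxE mulrA. Qed.

Lemma dotNl n (u v : 'cV[R]_n) : dot (- u) v = - dot u v.
Proof. by rewrite -scaleN1r dotZl mulN1r. Qed.

Lemma dotBl n (u v w : 'cV[R]_n) : dot (u - v) w = dot u w - dot v w.
Proof. by rewrite dotDl dotNl. Qed.

Lemma dotDr n (u v w : 'cV[R]_n) : dot u (v + w) = dot u v + dot u w.
Proof. by rewrite ![dot u _]dotC dotDl. Qed.

Lemma dotZr n a (u v : 'cV[R]_n) : dot u (a *: v) = a * dot u v.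
Proof. by rewrite ![dot u _]dotC dotZl. Qed.

Lemma dotNr n (u v : 'cV[R]_n) : dot u (- v) = - dot u v.
Proof. by rewrite ![dot u _]dotC dotNl. Qed.

Lemma dotBr n (u v w : 'cV[R]_n) : dot u (v - w) = dot u v - dot u w.
Proof. by rewrite dotDr dotNr. Qed.

Lemma dot0l n (u : 'cV[R]_n) : dot 0 u = 0.
Proof. by rewrite -(scale0r 0) dotZl mul0r. Qed.

Lemma dot0r n (u : 'cV[R]_n) : dot u 0 = 0.
Proof. by rewrite dotC dot0l. Qed.

Lemma dot_mulmx m n (M : 'M[R]_(m, n)) (u : 'cV_m) (v : 'cV_n) :
  dot u (M *m v) = dot (M^T *m u) v.
Proof. by rewrite !dotE trmx_mul trmxK mulmxA. Qed.

Lemma dot_ge0 n (u : 'cV[R]_n) : 0 <= dot u u.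
Proof. by apply: sumr_ge0 => i _; rewrite -expr2 sqr_ge0. Qed.

Lemma dot_eq0 n (u : 'cV[R]_n) : dot u u = 0 -> u = 0.
Proof.
move=> /eqP; rewrite psumr_eq0 => [/allP u0|i _]; last by rewrite -expr2 sqr_ge0.
apply/colP => i; apply/eqP; rewrite mxE.
by have := u0 i (mem_index_enum _); rewrite /= mulf_eq0 orbb.
Qed.

(** The form of [M] is nonnegative at [x - s *: y] for every [s], so its discriminant is not
    positive. *)
Lemma psd_CauchySchwarz n (M : 'M[R]_n) (x y : 'cV_n) : sym_psd M ->
  dot x (M *m y) ^+ 2 <= dot x (M *m x) * dot y (M *m y).
Proof.
move=> [Msym Mpsd]; apply: discriminant_le => // s.
have := Mpsd (x - s *: y).
rewrite mulmxBr -scalemxAr !(dotBl, dotBr, dotZl, dotZr).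
rewrite (dot_mulmx M y x) Msym (dotC _ x); congr (_ <= _); ring.
Qed.

Lemma sym_psd1 n : sym_psd (1%:M : 'M[R]_n).
Proof. by split=> [|x]; rewrite ?trmx1// mul1mx dot_ge0. Qed.

Lemma norm2_ge0 n (u : 'cV[R]_n) : 0 <= norm2 u.
Proof. exact: sqrtr_ge0. Qed.

Lemma sqr_norm2 n (u : 'cV[R]_n) : norm2 u ^+ 2 = dot u u.
Proof. by rewrite sqr_sqrtr ?dot_ge0. Qed.

Lemma dot_le_norm2 n (u v : 'cV[R]_n) : dot u v <= norm2 u * norm2 v.
Proof.
apply: sqr_le_pos; first by rewrite mulr_ge0 ?norm2_ge0.
rewrite exprMn !sqr_norm2; have := psd_CauchySchwarz u v (@sym_psd1 n).
by rewrite !mul1mx.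
Qed.

Lemma norm2Z n a (u : 'cV[R]_n) : norm2 (a *: u) = `|a| * norm2 u.
Proof.
by rewrite /norm2 dotZl dotZr mulrA -expr2 sqrtrM ?sqr_ge0// sqrtr_sqr.
Qed.

Lemma norm20 n : norm2 (0 : 'cV[R]_n) = 0.
Proof. by rewrite -(scale0r 0) norm2Z normr0 mul0r. Qed.

Lemma norm2N n (u : 'cV[R]_n) : norm2 (- u) = norm2 u.
Proof. by rewrite -scaleN1r norm2Z normrN1 mul1r. Qed.

Lemma norm2D n (u v : 'cV[R]_n) : norm2 (u + v) <= norm2 u + norm2 v.
Proof.
apply: sqr_le_pos; first by rewrite addr_ge0 ?norm2_ge0.
rewrite sqrrD !sqr_norm2 dotDl !dotDr (dotC v u).
have := dot_le_norm2 u v; lra.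
Qed.

Lemma norm2B n (u v : 'cV[R]_n) : norm2 (u - v) <= norm2 u + norm2 v.
Proof. by rewrite -(norm2N v) norm2D. Qed.

Lemma dot_col_mx m n (u u' : 'cV[R]_m) (v v' : 'cV[R]_n) :
  dot (col_mx u v) (col_mx u' v') = dot u u' + dot v v'.
Proof. by rewrite !dotE tr_col_mx mul_row_col mxE. Qed.

Lemma norm2_col_mx_le m n (u : 'cV[R]_m) (v : 'cV[R]_n) :
  norm2 (col_mx u v) <= norm2 u + norm2 v.
Proof.
apply: sqr_le_pos; first by rewrite addr_ge0 ?norm2_ge0.
rewrite sqrrD !sqr_norm2 dot_col_mx.
have := norm2_ge0 u; have := norm2_ge0 v; nra.
Qed.

Lemma norm2_le_col_mxl m n (u : 'cV[R]_m) (v : 'cV[R]_n) :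
  norm2 u <= norm2 (col_mx u v).
Proof.
apply: sqr_le_pos; first exact: norm2_ge0.
by rewrite !sqr_norm2 dot_col_mx; have := dot_ge0 v; lra.
Qed.

Lemma norm2_le_col_mxr m n (u : 'cV[R]_m) (v : 'cV[R]_n) :
  norm2 v <= norm2 (col_mx u v).
Proof.
apply: sqr_le_pos; first exact: norm2_ge0.
by rewrite !sqr_norm2 dot_col_mx; have := dot_ge0 u; lra.
Qed.

Lemma entry_le_norm2 n (u : 'cV[R]_n) i : `|u i 0| <= norm2 u.
Proof.
apply: sqr_le_pos; first exact: norm2_ge0.
rewrite sqr_norm2 real_normK ?num_real// /dot (bigD1 i)//= -expr2 lerDl.
by apply: sumr_ge0 => j _; rewrite -expr2 sqr_ge0.
Qed.

Lemma norm2_le_sum n (u : 'cV[R]_n) : norm2 u <= \sum_i `|u i 0|.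
Proof.
apply: sqr_le_pos; first exact: sumr_ge0.
rewrite sqr_norm2 expr2 mulr_suml; apply: ler_sum => i _.
rewrite -expr2 -real_normK ?num_real// expr2 ler_wpM2l//.
by rewrite (bigD1 i)//= lerDl sumr_ge0.
Qed.

Lemma norm2_le_const n (u : 'cV[R]_n) c : (forall i, `|u i 0| <= c) ->
  norm2 u <= c * n%:R.
Proof.
move=> uc; apply: le_trans (norm2_le_sum u) _.
apply: le_trans (ler_sum _ (fun i _ => uc i)) _.
by rewrite sumr_const card_ord mulr_natr.
Qed.

Lemma entry_le_norm n (u : 'cV[R]_n) i : `|u i 0| <= `|u|.
Proof.
rewrite [X in _ <= X]mx_normrE; exact: (@le_bigmax _ _ _ _ (fun i => `|u i.1 i.2|) (i, 0)).
Qed.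

End InnerProduct.

(** * Singular values and eigenvalues as operator bounds *)

Section Spectrum.
Context {R : realType}.

Lemma mulmx_bounded m n (M : 'M[R]_(m, n)) :
  exists2 L : R, 0 <= L & forall x : 'cV_n, norm2 (M *m x) <= L * norm2 x.
Proof.
exists (\sum_i \sum_j `|M i j|); first by do 2![apply: sumr_ge0 => ? _].
move=> x; apply: le_trans (norm2_le_sum _) _.
rewrite mulr_suml; apply: ler_sum => i _.
rewrite mxE mulr_suml; apply: le_trans (ler_norm_sum _ _ _) _.
by apply: ler_sum => j _; rewrite normrM ler_wpM2l// entry_le_norm2.
Qed.

(** Cauchy-Schwarz for the form of [M], at x and M^-1 x, gives |x|^4 <= (x.Mx) (x.M^-1 x) <= (x.Mx)
    L |x|^2, where [L] bounds the inverse. The constant uses [L + 1] because [L] may be 0. *)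
Lemma psd_unit_coercive n (M : 'M[R]_n) : sym_psd M -> M \in unitmx ->
  exists2 d : R, 0 < d & forall x : 'cV_n, d * dot x x <= dot x (M *m x).
Proof.
move=> Mpsd Mu; have [L L0 invL] := mulmx_bounded (invmx M).
have L1 : 0 < L + 1 by lra.
exists (L + 1)^-1 => [|x]; first by rewrite invr_gt0.
rewrite mulrC ler_pdivrMr//.
have /= := psd_CauchySchwarz x (invmx M *m x) Mpsd.
rewrite mulKVmx//; have := dot_le_norm2 (invmx M *m x) x.
have := invL x; have := norm2_ge0 x; rewrite -!(sqr_norm2 x).
have := Mpsd.2 x; move: (dot x (M *m x)) (dot _ x) (norm2 (invmx M *m x)) => q d k.
move: (norm2 x) => s q0 s0 ks dks sqd.
have dLs : d <= L * s ^+ 2 by apply: le_trans dks _; rewrite expr2 mulrA ler_wpM2r.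
have : (s ^+ 2) ^+ 2 <= q * L * s ^+ 2.
  by apply: le_trans sqd _; rewrite -mulrA ler_wpM2l.
rewrite [X in X <= _]expr2.
have [->|sn0] := eqVneq s 0; first by rewrite expr0n /= => _; rewrite mulr_ge0// ltW.
rewrite ler_pM2r ?exprn_gt0// ?lt_def ?sn0// => h; lra.
Qed.

(* The infimum of the Rayleigh quotient is an eigenvalue: otherwise the shifted
   matrix would be invertible, hence coercive, and the infimum larger. *)
Lemma rayleigh_min_eigenvalue n (S : 'M[R]_n) : (0 < n)%N -> S^T = S ->
  exists2 a, eigenvalue S a & forall x : 'cV_n, a * dot x x <= dot x (S *m x).
Proof.
move=> n0 Ssym; have [L L0 SL] := mulmx_bounded S.
pose E := [set r | exists x : 'cV[R]_n, dot x x = 1 /\ r = dot x (S *m x)]%classic.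
have E0 : (E !=set0)%classic.
  pose e : 'cV[R]_n := delta_mx (Ordinal n0) 0.
  exists (dot e (S *m e)), e; split=> //.
  rewrite /dot (bigD1 (Ordinal n0))//= !mxE !eqxx mulr1 big1 ?addr0// => i ine.
  by rewrite !mxE (negPf ine) mul0r.
have lbE : has_lbound E.
  exists (- L) => _ [x [x1 ->]].
  have := dot_le_norm2 (- x) (S *m x).
  rewrite dotNl norm2N /norm2 x1 sqrtr1 mul1r -[Num.sqrt _]/(norm2 _).
  have := SL x; rewrite {2}/norm2 x1 sqrtr1; lra.
have aE : forall x, E x -> inf E <= x by move=> r; apply: ge_inf.
have leA : forall r, lbound E r -> r <= inf E by move=> r; apply: lb_le_inf.
move: (inf E) aE leA => a aE leA.
have aS x : a * dot x x <= dot x (S *m x).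
  have [x0|xn0] := eqVneq (dot x x) 0.
    by rewrite x0 mulr0 (dot_eq0 x0) dot0l.
  have xp : 0 < dot x x by rewrite lt_def xn0 dot_ge0.
  have np : 0 < norm2 x by rewrite sqrtr_gt0.
  rewrite -ler_pdivlMr//; apply: aE.
  exists ((norm2 x)^-1 *: x); split.
    by rewrite dotZl dotZr -sqr_norm2; field; exact: lt0r_neq0.
  by rewrite -scalemxAr dotZl dotZr -sqr_norm2; field; exact: lt0r_neq0.
exists a => //.
have Mpsd : sym_psd (S - a%:M).
  split=> [|x]; first by rewrite linearB /= Ssym tr_scalar_mx.
  by rewrite mulmxBl mul_scalar_mx dotBr dotZr subr_ge0.
rewrite /eigenvalue /eigenspace kermx_eq0 row_free_unit.
apply/negP => /(psd_unit_coercive Mpsd)[d d0 dM].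
have /leA : (lbound E (a + d))%classic.
  move=> _ [x [x1 ->]]; have := dM x.
  rewrite mulmxBl mul_scalar_mx dotBr dotZr x1; lra.
by lra.
Qed.

Lemma eigenvalueN n (S : 'M[R]_n) a : eigenvalue (- S) a = eigenvalue S (- a).
Proof.
apply/eigenvalueP/eigenvalueP => -[v vS v0]; exists v => //.
  by rewrite scaleNr -vS mulmxN opprK.
by rewrite mulmxN vS scaleNr opprK.
Qed.

Lemma rayleigh_max_eigenvalue n (S : 'M[R]_n) : (0 < n)%N -> S^T = S ->
  exists2 a, eigenvalue S a & forall x : 'cV_n, dot x (S *m x) <= a * dot x x.
Proof.
move=> n0 Ssym; have [|a] := @rayleigh_min_eigenvalue n (- S) n0.
  by rewrite linearN /= Ssym.
rewrite eigenvalueN => Sa ale; exists (- a) => // x.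
by have := ale x; rewrite mulNmx dotNr mulNr; lra.
Qed.

(** Library eigenvectors are rows; by symmetry the transpose is a column eigenvector. *)
Lemma eigenvalue_dot n (S : 'M[R]_n) a : S^T = S -> eigenvalue S a ->
  exists2 x : 'cV_n, 0 < dot x x & dot x (S *m x) = a * dot x x.
Proof.
move=> Ssym /eigenvalueP[v vS v0]; exists v^T.
  rewrite lt_def dot_ge0 andbT; apply: contra v0 => /eqP/dot_eq0 vT0.
  by rewrite -(trmxK v) vT0 trmx0.
have -> : S *m v^T = a *: v^T by rewrite -{1}Ssym -trmx_mul vS linearZ.
by rewrite dotZr.
Qed.

(** The largest Rayleigh quotient is an eigenvalue and bounds all the others, so the [sup] is that
    of a bounded set and dominates this quotient. *)
Lemma nu_max_ge n (Q : 'M[R]_n) (x : 'cV_n) : (0 < n)%N -> Q^T = Q ->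
  dot x (Q *m x) <= nu_max Q * dot x x.
Proof.
move=> n0 Qsym; have [a Qa aQ] := rayleigh_max_eigenvalue n0 Qsym.
apply: le_trans (aQ x) _; rewrite ler_wpM2r ?dot_ge0//.
apply: ub_le_sup => //; exists a => b /(eigenvalue_dot Qsym)[v v0 vQ].
by have := aQ v; rewrite vQ ler_pM2r.
Qed.

Lemma gram_sym m n (A : 'M[R]_(m, n)) : (A *m A^T)^T = A *m A^T.
Proof. by rewrite trmx_mul trmxK. Qed.

Lemma dot_gram m n (A : 'M[R]_(m, n)) (y : 'cV_m) :
  dot y (A *m A^T *m y) = norm2 (A^T *m y) ^+ 2.
Proof. by rewrite -mulmxA dot_mulmx sqr_norm2. Qed.

Lemma gram_eigenvalue_ge0 m n (A : 'M[R]_(m, n)) a :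
  eigenvalue (A *m A^T) a -> 0 <= a.
Proof.
move=> /(eigenvalue_dot (gram_sym A))[v v0]; rewrite dot_gram => e.
by rewrite -(pmulr_lge0 _ v0) -e sqr_ge0.
Qed.

(** |A^T y|^2 is the quadratic form of [A *m A^T], and the square root of the least eigenvalue of
    that matrix belongs to the set whose [inf] is taken. *)
Lemma eta_min_le m n (A : 'M[R]_(m, n)) (y : 'cV_m) : (0 < m)%N ->
  eta_min A * norm2 y <= norm2 (A^T *m y).
Proof.
move=> m0; have [a Aa aA] := rayleigh_min_eigenvalue m0 (gram_sym A).
have a0 := gram_eigenvalue_ge0 Aa.
apply: (@le_trans _ _ (Num.sqrt a * norm2 y)).
  rewrite ler_wpM2r ?norm2_ge0//; apply: ge_inf; first by exists 0 => ? [].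
  by split; rewrite ?sqrtr_ge0// sqr_sqrtr.
apply: sqr_le_pos; first exact: norm2_ge0.
by rewrite exprMn (sqr_sqrtr a0) -dot_gram sqr_norm2.
Qed.

Lemma norm2_trmx_le m n (A : 'M[R]_(m, n)) (y : 'cV_m) : (0 < m)%N ->
  norm2 (A^T *m y) <= eta_max A * norm2 y.
Proof.
move=> m0; have [a Aa aA] := rayleigh_max_eigenvalue m0 (gram_sym A).
have a0 := gram_eigenvalue_ge0 Aa.
apply: (@le_trans _ _ (Num.sqrt a * norm2 y)).
  apply: sqr_le_pos; first by rewrite mulr_ge0 ?sqrtr_ge0 ?norm2_ge0.
  by rewrite exprMn (sqr_sqrtr a0) -dot_gram sqr_norm2.
rewrite ler_wpM2r ?norm2_ge0//; apply: ub_le_sup; last first.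
  by split; rewrite ?sqrtr_ge0// sqr_sqrtr.
exists (Num.sqrt a) => s [s0 /(eigenvalue_dot (gram_sym A))[v v0 vA]].
apply: sqr_le_pos; first exact: sqrtr_ge0.
by rewrite sqr_sqrtr//; have := aA v; rewrite vA ler_pM2r.
Qed.

(** A matrix and its transpose have the same operator norm: |Ax|^2 = A^T(Ax).x <= L |Ax| |x|. *)
Lemma norm2_mulmx_le m n (A : 'M[R]_(m, n)) L (x : 'cV_n) : 0 <= L ->
  (forall y, norm2 (A^T *m y) <= L * norm2 y) -> norm2 (A *m x) <= L * norm2 x.
Proof.
move=> L0 AL; have [->|An0] := eqVneq (norm2 (A *m x)) 0.
  by rewrite mulr_ge0 ?norm2_ge0.
have Ap : 0 < norm2 (A *m x) by rewrite lt_def An0 norm2_ge0.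
rewrite -(ler_pM2r Ap) -expr2 sqr_norm2 dot_mulmx.
apply: le_trans (dot_le_norm2 _ _) _.
by rewrite mulrAC ler_wpM2r ?norm2_ge0.
Qed.

(** Cauchy-Schwarz for the form of [Q], at x and Qx: |Qx|^4 <= (x.Qx) (Qx.QQx) <= L^2 |x|^2
    |Qx|^2. *)
Lemma norm2_psd_le n (Q : 'M[R]_n) L (x : 'cV_n) : 0 <= L -> sym_psd Q ->
  (forall x, dot x (Q *m x) <= L * dot x x) -> norm2 (Q *m x) <= L * norm2 x.
Proof.
move=> L0 Qpsd QL.
have [->|An0] := eqVneq (norm2 (Q *m x)) 0.
  by rewrite mulr_ge0 ?norm2_ge0.
have Ap : 0 < norm2 (Q *m x) ^+ 2 by rewrite exprn_gt0// lt_def An0 norm2_ge0.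
apply: sqr_le_pos; first by rewrite mulr_ge0 ?norm2_ge0.
rewrite -(ler_pM2r Ap) -expr2.
have -> : norm2 (Q *m x) ^+ 2 = dot x (Q *m (Q *m x)).
  by rewrite sqr_norm2 [RHS]dot_mulmx Qpsd.1.
apply: le_trans (psd_CauchySchwarz _ _ Qpsd) _.
have -> : (L * norm2 x) ^+ 2 * dot x (Q *m (Q *m x)) =
    (L * dot x x) * (L * dot (Q *m x) (Q *m x)).
  by rewrite (dot_mulmx Q x) Qpsd.1 -!sqr_norm2; ring.
by apply: ler_pM => //; exact: Qpsd.2.
Qed.

End Spectrum.

(** * Strong duality *)

Section Duality.
Context {R : realType}.

(* Bartl's induction.  If the last generator a is needed, some h satisfies
   v.h <= 0 on the other generators and g.h > 0 = 1 - a.h; subtracting the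
   multiples (v.h) a and (g.h) a projects along a onto the orthogonal of h. *)
Lemma Farkas n (K : 'cV[R]_n -> Prop) (s : seq 'cV[R]_n) (g : 'cV[R]_n) :
  K 0 -> (forall u v, K u -> K v -> K (u + v)) ->
  (forall t u, 0 <= t -> K u -> K (t *: u)) ->
  (forall v, v \in s -> K v) ->
  (forall x, (forall v, v \in s -> dot v x <= 0) -> dot g x <= 0) -> K g.
Proof.
move=> K0 KD KZ.
have [k] := ubnP (size s); elim: k s g => // k IH [|a s] g /= sk Ks sg.
  suff -> : g = 0 by [].
  by apply: dot_eq0; apply/eqP; rewrite eq_le dot_ge0 andbT; exact: sg.
have Ka : K a by apply: Ks; rewrite mem_head.
have {}Ks v : v \in s -> K v by move=> vs; apply: Ks; rewrite inE vs orbT.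
have [sg'|/existsNP[h0 /not_implyP[sh0 /negP]]] :=
  pselect (forall x, (forall v, v \in s -> dot v x <= 0) -> dot g x <= 0).
  exact: (IH s).
rewrite -ltNge => gh0.
have ah0 : 0 < dot a h0.
  rewrite ltNge; apply/negP => ah0; move: gh0; rewrite ltNge => /negP; apply.
  by apply: sg => v; rewrite inE => /orP[/eqP ->//|]; exact: sh0.
pose h := (dot a h0)^-1 *: h0.
have ah : dot a h = 1 by rewrite dotZr mulVf// gt_eqF.
have gh : 0 < dot g h by rewrite dotZr mulr_gt0// invr_gt0.
have sh v : v \in s -> dot v h <= 0.
  by move=> /sh0 vh; rewrite dotZr pmulr_rle0// invr_gt0.
clearbody h.
pose proj (v : 'cV[R]_n) := v - dot v h *: a.
suff : K (proj g).
  move=> Kg; rewrite -(subrK (dot g h *: a) g).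
  by apply: KD => //; apply: KZ => //; exact: ltW.
have projE v x : dot (proj v) x = dot v (x - dot a x *: h).
  by rewrite dotBl dotZl dotBr dotZr mulrC.
apply: (IH (map proj s)); rewrite ?size_map//.
  move=> _ /mapP[v vs ->]; rewrite /proj -scaleNr; apply: KD; first exact: Ks.
  by apply: KZ; rewrite // oppr_ge0 sh.
move=> x sx; rewrite projE; apply: sg => v; rewrite inE => /orP[/eqP ->|vs].
  by rewrite dotBr dotZr ah mulr1 subrr.
by rewrite -projE sx// map_f.
Qed.

Lemma feasible_direction n (x d : 'cV[R]_n) :
  (forall i, 0 <= x i 0) -> (forall i, x i 0 = 0 -> 0 <= d i 0) ->
  exists2 e : R, 0 < e & forall t, 0 <= t <= e -> forall i, 0 <= x i 0 + t * d i 0.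
Proof.
(* Indices with [x i 0 = 0] contribute 0 to [S], division by zero being 0. For the others,
   [t <= (1 + S)^-1] makes [t * |d i 0|] at most [x i 0]. *)
move=> x0 xd; pose S := \sum_i `|d i 0| / x i 0.
have dx i : 0 <= `|d i 0| / x i 0 by rewrite divr_ge0.
have S1 : 0 < 1 + S by rewrite ltr_wpDr// sumr_ge0.
exists (1 + S)^-1; first by rewrite invr_gt0.
move=> t /andP[t0 tS] i; have [xi|xi] := eqVneq (x i 0) 0.
  by rewrite xi add0r mulr_ge0// xd.
have xp : 0 < x i 0 by rewrite lt_def xi x0.
have : t * (`|d i 0| / x i 0) <= 1.
  apply: (@le_trans _ _ ((1 + S)^-1 * (1 + S))); last by rewrite mulVf ?gt_eqF.
  apply: ler_pM => //; rewrite /S (bigD1 i)//= addrCA lerDl.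
  by rewrite addr_ge0// sumr_ge0.
rewrite mulrA ler_pdivrMr// mul1r => tdx.
have := ler_norm (- d i 0); rewrite normrN; nra.
Qed.

Lemma optimal_gradient m n (P : qp R m n) (x d : 'cV[R]_n) :
  sym_psd (qpQ P) -> primal_feasible P x ->
  (forall x', primal_feasible P x' -> primal_obj P x <= primal_obj P x') ->
  qpA P *m d = 0 -> (forall i, x i 0 = 0 -> 0 <= d i 0) ->
  0 <= dot (qpc P + qpQ P *m x) d.
Proof.
move=> [Qsym Qpsd] [Ax x0] xopt Ad xd.
have [e e0 xe] := feasible_direction x0 xd.
have grad t : 0 < t <= e ->
    0 <= dot (qpc P + qpQ P *m x) d + t / 2 * dot d (qpQ P *m d).
  move=> /andP[t0 te]; have := xopt (x + t *: d).
  rewrite /primal_feasible mulmxDr -scalemxAr Ad scaler0 addr0.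
  have xd0 i : 0 <= (x + t *: d) i 0 by rewrite !mxE xe// ltW.
  move=> /(_ (conj Ax xd0)).
  rewrite /primal_obj mulmxDr -scalemxAr !(dotDl, dotDr, dotZl, dotZr).
  rewrite (dot_mulmx _ x d) Qsym (dotC d (_ *m x)) => h.
  by rewrite -(pmulr_rge0 _ t0); lra.
have := Qpsd d; move: grad; move: (dot _ d) (dot d _) => r q grad q0.
rewrite leNgt; apply/negP => r0.
(* If the slope [r] were negative, this feasible [t] would make [r + t / 2 * q] negative; [q + 1] is
   used because [q] may vanish. *)
pose t := Num.min e (- r / (q + 1)).
have q1 : 0 < q + 1 by lra.
have t0 : 0 < t by rewrite lt_min e0 divr_gt0// oppr_gt0.
have tr : t * (q + 1) <= - r by rewrite -ler_pdivlMr// ge_min lexx orbT.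
have : 0 < t <= e by rewrite t0 ge_min lexx.
by move=> /grad; nra.
Qed.

(** Farkas' lemma, applied to the first-order condition at x, yields multipliers (y', z') with x.z'
    = 0. Then (x, y', z') is dual feasible, and since (x, y, z) is dual optimal, x.z <= x.z' = 0. *)
Lemma optimal_complementary m n (P : qp R m n) x y z :
  sym_psd (qpQ P) -> optimal_solution P x y z -> dot x z = 0.
Proof.
move=> Qpsd [xf xopt [yz z0] yopt]; have [Ax x0] := xf.
pose g := qpc P + qpQ P *m x.
have xAy y' : dot (qpb P) y' = dot x ((qpA P)^T *m y').
  by rewrite -Ax dotC dot_mulmx dotC.
(* [K] is the cone of the multipliers sought: since x and z are nonnegative, x.z = 0 confines z to
   the active indices of x. *)
pose K v := exists y z, [/\ v = - ((qpA P)^T *m y + z),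
  forall i, 0 <= z i 0 & dot x z = 0].
suff [y' [z' [/oppr_inj gE z'0 xz']]] : K (- g).
  have : dual_feasible P x y' z' by split=> //; rewrite -addrA -gE addrC addrK.
  move=> /yopt; rewrite /dual_obj lerBrDr subrK !xAy.
  have -> : (qpA P)^T *m y' = g - z' by rewrite gE addrK.
  have -> : (qpA P)^T *m y = g - z.
    by rewrite /g -yz; apply/colP => i; rewrite !mxE; ring.
  rewrite !dotBr xz' => h; apply/eqP; rewrite eq_le; apply/andP; split; first lra.
  by apply: sumr_ge0 => i _; rewrite mulr_ge0.
(* Generators of the cone: the rows of A with both signs and the opposites of the active unit
   vectors. A direction d with nonpositive products against all of them satisfies A d = 0 and is
   nonnegative on the active indices. *)
pose rows := [seq col j (qpA P)^T | j <- enum 'I_m].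
pose s := rows ++ map -%R rows ++
  [seq - delta_mx i 0 | i <- [seq i <- enum 'I_n | x i 0 == 0]].
apply: (@Farkas _ K s).
- exists 0, 0; split; rewrite ?mulmx0 ?addr0 ?oppr0 ?dot0r// => i.
  by rewrite mxE.
- move=> _ _ [y1 [z1 [-> z10 xz1]]] [y2 [z2 [-> z20 xz2]]].
  exists (y1 + y2), (z1 + z2); split; last by rewrite dotDr xz1 xz2 addr0.
    by rewrite mulmxDr -opprD addrACA.
  by move=> i; rewrite mxE addr_ge0.
- move=> t _ t0 [y1 [z1 [-> z10 xz1]]]; exists (t *: y1), (t *: z1); split.
  + by rewrite scalerN scalerDr scalemxAr.
  + by move=> i; rewrite mxE mulr_ge0.
  + by rewrite dotZr xz1 mulr0.
- have K0 y' : K (- ((qpA P)^T *m y')).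
    by exists y', 0; split; rewrite ?addr0 ?dot0r// => i; rewrite mxE.
  move=> v; rewrite !mem_cat => /or3P[/mapP[j _ ->]|/mapP[_ /mapP[j _ ->] ->]|].
  + by rewrite colE -[_ *m _]opprK -mulmxN.
  + by rewrite colE.
  + move=> /mapP[i]; rewrite mem_filter => /andP[/eqP xi _] ->.
    exists 0, (delta_mx i 0); split; first by rewrite mulmx0 add0r.
      by move=> j; rewrite mxE ler0n.
    rewrite /dot big1// => j _; rewrite mxE eqxx andbT.
    by have [->|_] := eqVneq j i; rewrite ?xi ?mul0r ?mulr0.
move=> d sd; rewrite dotNl oppr_le0; apply: optimal_gradient => //.
  apply/colP => j; rewrite [RHS]mxE.
  have -> : (qpA P *m d) j 0 = dot (col j (qpA P)^T) d.
    by rewrite mxE; apply: eq_bigr => i _; rewrite !mxE.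
  have jr : col j (qpA P)^T \in rows.
    by apply: (map_f (fun j => col j (qpA P)^T)); rewrite mem_enum.
  apply/eqP; rewrite eq_le; apply/andP; split.
    by apply: sd; rewrite mem_cat jr.
  by rewrite -oppr_le0 -dotNl; apply: sd; rewrite !mem_cat (map_f -%R jr) orbT.
move=> i xi; have /sd : - delta_mx i 0 \in s.
  rewrite !mem_cat (map_f (fun i => - delta_mx i 0)) ?orbT//.
  by rewrite mem_filter xi eqxx mem_enum.
rewrite dotNl oppr_le0 /dot (bigD1 i)//= mxE !eqxx mul1r big1 ?addr0// => j ji.
by rewrite mxE (negPf ji) mul0r.
Qed.

End Duality.

(** * The monotonicity inequality *)

Lemma saddle_monotone (R : realType) m n (A : 'M[R]_(m, n)) (Q : 'M[R]_n)
    (x z v : 'cV_n) (y u : 'cV_m) mu :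
  sym_psd Q -> A *m x = - (mu *: u) -> z = Q *m x - A^T *m y + mu *: v ->
  mu * (dot y u + dot x v) <= dot x z.
Proof.
move=> [_ Qpsd] Ax ->; rewrite dotDr dotBr dotZr dot_mulmx.
rewrite (dot_mulmx A^T) trmxK Ax dotNl dotZl (dotC u y).
by have := Qpsd x; rewrite dot_mulmx; lra.
Qed.

(** * The semi-norm *)

Section Seminorm.
Context {R : realType} {m n : nat} (P : qp R m n) (CA1 CQ : R).
Local Notation A := (qpA P).
Local Notation Q := (qpQ P).
Context (CA1_gt0 : 0 < CA1) (A_ge : forall y, CA1 * norm2 y <= norm2 (A^T *m y)).
Context (CQ_ge0 : 0 <= CQ) (Q_le : forall x, norm2 (Q *m x) <= CQ * norm2 x).

Lemma gram_unitmx : A *m A^T \in unitmx.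
Proof.
rewrite -row_free_unit -kermx_eq0; apply: contraT => ker0.
have /(eigenvalue_dot (gram_sym A))[y y0] : eigenvalue (A *m A^T) 0.
  by rewrite /eigenvalue /eigenspace raddf0 subr0.
rewrite mul0r dot_gram => /eqP; rewrite sqrf_eq0 => /eqP ATy.
have := A_ge y; rewrite ATy pmulr_rle0// => ny.
by move: y0; rewrite -sqr_norm2 exprn_even_gt0//= => /negP[]; rewrite eq_le ny norm2_ge0.
Qed.

(** The least-norm solution x = A^T w, with w = (A A^T)^-1 b, satisfies |x|^2 = w.b <= |w| |b|, and
    [CA1 * |w| <= |x|]. *)
Lemma bounded_preimage (b : 'cV_m) :
  exists2 x, A *m x = b & norm2 x <= CA1^-1 * norm2 b.
Proof.
pose w := invmx (A *m A^T) *m b; exists (A^T *m w).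
  by rewrite mulmxA mulKVmx// gram_unitmx.
have := dot_gram A w; rewrite [in dot _ _]mulKVmx ?gram_unitmx// => wE.
have := dot_le_norm2 w b; rewrite wE.
have := A_ge w; have := norm2_ge0 w; have := norm2_ge0 b.
move: (norm2 w) (norm2 b) (norm2 _) (norm2_ge0 (A^T *m w)) => s r t t0 r0 s0 st ts.
rewrite ler_pdivlMl//; move: t0; rewrite le_eqVlt => /orP[/eqP <-|t0].
  by rewrite mulr0.
rewrite -(ler_pM2r t0) -mulrA -expr2.
apply: (@le_trans _ _ (CA1 * (s * r))); first by rewrite ler_pM2l.
by rewrite mulrA (mulrC r) ler_wpM2r.
Qed.

Lemma seminorm_le b' c' x y z :
  A *m x = b' -> - (Q *m x) + A^T *m y + z = c' ->
  seminorm P b' c' <= norm2 (col_mx x z).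
Proof.
move=> Ax Az; apply: ge_inf; last by exists x, y, z.
by exists 0 => _ [? [? [? [_ _ ->]]]]; exact: norm2_ge0.
Qed.

(** The infimum is approached up to any slack, hence the strict bound. Surjectivity of A makes the
    set nonempty: take y = 0 and let z absorb the dual equation. *)
Lemma seminorm_witness b' c' r : seminorm P b' c' < r ->
  exists x y z, [/\ A *m x = b', - (Q *m x) + A^T *m y + z = c' &
    norm2 (col_mx x z) < r].
Proof.
move=> /inf_lt[].
  have [x Ax _] := bounded_preimage b'.
  exists (norm2 (col_mx x (c' + Q *m x))), x, 0, (c' + Q *m x); split=> //.
  by rewrite mulmx0 addr0 addrC addrK.
by move=> _ [x [y [z [? ? ->]]]] ?; exists x, y, z.
Qed.

Lemma seminormD b1 c1 b2 c2 :
  seminorm P (b1 + b2) (c1 + c2) <= seminorm P b1 c1 + seminorm P b2 c2.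
Proof.
apply/ler_addgt0Pr => e e0; have e2 : 0 < e / 2 by lra.
have [|x1 [y1 [z1 [Ax1 Az1 n1]]]] := @seminorm_witness b1 c1 (seminorm P b1 c1 + e / 2).
  by lra.
have [|x2 [y2 [z2 [Ax2 Az2 n2]]]] := @seminorm_witness b2 c2 (seminorm P b2 c2 + e / 2).
  by lra.
have : seminorm P (b1 + b2) (c1 + c2) <= norm2 (col_mx (x1 + x2) (z1 + z2)).
  apply: (@seminorm_le _ _ _ (y1 + y2)); first by rewrite mulmxDr Ax1 Ax2.
  by rewrite -Az1 -Az2 !mulmxDr; apply/colP => i; rewrite !mxE; ring.
rewrite -add_col_mx; have := norm2D (col_mx x1 z1) (col_mx x2 z2); lra.
Qed.

Lemma seminormZ s b' c' : 0 <= s -> seminorm P (s *: b') (s *: c') <= s * seminorm P b' c'.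
Proof.
move=> s0; apply/ler_addgt0Pr => e e0.
have s1 : 0 < s + 1 by lra.
(* The denominator [s + 1] keeps the slack defined and positive when [s = 0]. *)
have es : 0 < e / (s + 1) by rewrite divr_gt0.
have [|x [y [z [Ax Az nxz]]]] := @seminorm_witness b' c' (seminorm P b' c' + e / (s + 1)).
  by lra.
have : seminorm P (s *: b') (s *: c') <= norm2 (col_mx (s *: x) (s *: z)).
  apply: (@seminorm_le _ _ _ (s *: y)); first by rewrite -scalemxAr Ax.
  by rewrite -Az -!scalemxAr; apply/colP => i; rewrite !mxE; ring.
rewrite -scale_col_mx norm2Z ger0_norm// => /le_trans; apply.
apply: (@le_trans _ _ (s * (seminorm P b' c' + e / (s + 1)))).
  by rewrite ler_wpM2l// ltW.
rewrite mulrDr lerD2l mulrA ler_pdivrMr// mulrC ler_wpM2l ?ltW//; lra.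
Qed.

(** The competitor is the bounded preimage x of b', with y = 0 and z = c' + Qx. *)
Lemma seminorm_le_norm2 b' c' :
  seminorm P b' c' <= (CA1^-1 * (1 + CQ) + 1) * (norm2 b' + norm2 c').
Proof.
have [x Ax nx] := bounded_preimage b'.
have : seminorm P b' c' <= norm2 (col_mx x (c' + Q *m x)).
  by apply: (@seminorm_le _ _ _ 0) => //; rewrite mulmx0 addr0 addrC addrK.
move=> /le_trans; apply; apply: le_trans (norm2_col_mx_le _ _) _.
have := norm2D c' (Q *m x); have := Q_le x; have := norm2_ge0 b'.
have := norm2_ge0 c'; have i0 : 0 <= CA1^-1 by rewrite invr_ge0 ltW.
move: nx (norm2_ge0 x); move: (norm2 x) (norm2 b') (norm2 c') (CA1^-1) i0.
move=> s p q i i0 nx s0 q0 p0 Qx ND.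
have CQ1 : 0 <= 1 + CQ. by rewrite addr_ge0.
have h1 : (1 + CQ) * s <= (1 + CQ) * (i * p) by rewrite ler_wpM2l.
have h2 : 0 <= i * (1 + CQ) * q by rewrite !mulr_ge0.
lra.
Qed.

End Seminorm.

(** * Bounds on the iterates *)

Record bounds (R : realType) := Bounds {
  lbA : R;
  ubA : R;
  ubQ : R;
  ub_opt : R;
  ub_y0 : R
}.

(* The data once the spectral hypotheses are turned into norm inequalities and
   the optimality of [(xs, ys, zs)] into the KKT conditions. *)
Record bounded_qp (R : realType) (par : parameters R) (k : bounds R) (m n : nat)
    (P : qp R m n) (y0 : 'cV[R]_m) (xs : 'cV[R]_n) (ys : 'cV[R]_m)
    (zs : 'cV[R]_n) : Prop := {
  bq_par : valid_parameters par;
  bq_dim : (0 < m <= n)%N;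
  bq_cst : [/\ 0 < lbA k, 0 <= ubA k, 0 <= ubQ k, 0 <= ub_opt k & 0 <= ub_y0 k];
  bq_psd : sym_psd (qpQ P);
  bq_lbA : forall y, lbA k * norm2 y <= norm2 ((qpA P)^T *m y);
  bq_ubAT : forall y, norm2 ((qpA P)^T *m y) <= ubA k * norm2 y;
  bq_ubA : forall x, norm2 (qpA P *m x) <= ubA k * norm2 x;
  bq_ubQ : forall x, norm2 (qpQ P *m x) <= ubQ k * norm2 x;
  bq_primal : qpA P *m xs = qpb P;
  bq_dual : - (qpQ P *m xs) + (qpA P)^T *m ys + zs = qpc P;
  bq_xs_ge0 : forall i, 0 <= xs i 0;
  bq_zs_ge0 : forall i, 0 <= zs i 0;
  bq_compl : dot xs zs = 0;
  bq_xs_le : forall i, `|xs i 0| <= ub_opt k;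
  bq_ys_le : forall i, `|ys i 0| <= ub_opt k;
  bq_zs_le : forall i, `|zs i 0| <= ub_opt k;
  bq_y0_le : forall i, `|y0 i 0| <= ub_y0 k
}.

Lemma mu0E (R : realType) m n (par : parameters R) (y0 : 'cV[R]_m) :
  (0 < n)%N -> mu0 (n := n) par y0 = rho par ^+ 2.
Proof.
move=> n0; rewrite /mu0 /mu /mu_of /dot /=.
under eq_bigr => i _ do rewrite !mxE.
by rewrite sumr_const card_ord -[_ *+ n]mulr_natr mulfK ?expr2// pnatr_eq0 -lt0n.
Qed.

(* Each constant [c_...] is the one hidden in an O(.) of the analysis; the powers
   of n stay explicit in the statements. *)
Section Constants.
Context {R : realType} (par : parameters R) (k : bounds R).

(** Half of the slack left by [gamma_A < 1]. The other half lets a near-minimiser of the semi-norm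
    have norm below [(1 - gap) * rho]. *)
Definition gap : R := (1 - gamma_A par) / 2.
Definition c_refx : R := 2 * rho par + ub_opt k.
Definition c_refy : R :=
  ub_y0 k + (lbA k)^-1 * (C_N par + ubQ k * rho par + rho par) + ub_opt k.
(** In [iterate_energy], X.Z accounts for four of the terms [rho ^+ 2] and for the mixed term, x.z
    for the fifth. *)
Definition c_energy : R := 5 * rho par ^+ 2 + 4 * rho par * ub_opt k.

End Constants.

Section IterateBounds.
Context {R : realType} {m n : nat} {par : parameters R} {k : bounds R}
  {P : qp R m n} {y0 : 'cV[R]_m} {xs : 'cV[R]_n} {ys : 'cV[R]_m} {zs : 'cV[R]_n}.
Context (H : bounded_qp par k P y0 xs ys zs).
Local Notation A := (qpA P).
Local Notation Q := (qpQ P).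
Local Notation N := (n%:R : R).
Local Notation x0 := (const_mx (rho par) : 'cV[R]_n).

Lemma n_gt0 : (0 < n)%N.
Proof. by case/andP: (bq_dim H) => /leq_trans /[apply]. Qed.

Lemma N_ge1 : 1 <= N.
Proof. by rewrite ler1n n_gt0. Qed.

Lemma rho_gt0 : 0 < rho par. Proof. by case: (bq_par H). Qed.

Lemma gap_gt0 : 0 < gap par.
Proof. by case: (bq_par H) => _ _ /andP[? ?] _ _; rewrite /gap; lra. Qed.

Lemma c_refx_ge0 : 0 <= c_refx par k.
Proof. by have := rho_gt0; case: (bq_cst H) => *; rewrite /c_refx; lra. Qed.

Lemma yshift_ge0 : 0 <= (lbA k)^-1 * (C_N par + ubQ k * rho par + rho par).
Proof.
case: (bq_cst H) => lA _ uQ _ _; case: (bq_par H) => r0 /ltW CN _ _ _.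
by rewrite mulr_ge0 ?invr_ge0 ?(ltW lA)// !addr_ge0 ?mulr_ge0 ?(ltW r0).
Qed.

Lemma c_refy_ge0 : 0 <= c_refy par k.
Proof. by have := yshift_ge0; case: (bq_cst H) => *; rewrite /c_refy; lra. Qed.

(** The dual equation gives A^T y in terms of the other vectors, and A^T is bounded below. *)
Lemma dual_bound (x z : 'cV[R]_n) (y : 'cV[R]_m) v :
  - (Q *m x) + A^T *m y + z = v ->
  norm2 y <= (lbA k)^-1 * (norm2 v + ubQ k * norm2 x + norm2 z).
Proof.
case: (bq_cst H) => lA _ _ _ _ E; rewrite ler_pdivlMl//.
apply: le_trans (bq_lbA H y) _.
have -> : A^T *m y = v + Q *m x - z.
  by rewrite -E; apply/colP => i; rewrite !mxE; ring.
apply: le_trans (norm2B _ _) _; rewrite lerD2r.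
by apply: le_trans (norm2D _ _) _; rewrite lerD2l (bq_ubQ H).
Qed.

Lemma mu_of_gt0 (x z : 'cV[R]_n) :
  (forall i, 0 < x i 0) -> (forall i, 0 < z i 0) -> 0 < mu_of x z.
Proof.
move=> x_gt0 z_gt0; rewrite divr_gt0 ?ltr0n ?n_gt0//.
rewrite /dot (bigD1 (Ordinal n_gt0))//= ltr_wpDr// ?mulr_gt0//.
by apply: sumr_ge0 => i _; rewrite mulr_ge0// ltW.
Qed.

Lemma dot_mu_of (x z : 'cV[R]_n) : dot x z = N * mu_of x z.
Proof. by rewrite /mu_of mulrC divfK// pnatr_eq0 -lt0n n_gt0. Qed.

(* [xb, yb, zb] realises the semi-norm of the perturbation; the residuals are
   those of a convex combination of the perturbed starting point and of the
   optimal solution. *)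
Lemma neighbourhood_reference mu zeta lambda x y z :
  neighbourhood par P y0 mu zeta lambda x y z ->
  exists (xb : 'cV[R]_n) (yb : 'cV[R]_m) (zb : 'cV[R]_n), let t := mu / rho par ^+ 2 in
  [/\ A *m x + mu *: (y - lambda)
        = A *m (t *: (x0 + xb) + (1 - t) *: xs),
      - (Q *m x) + A^T *m y + z - mu *: (x - zeta)
        = - (Q *m (t *: (x0 + xb) + (1 - t) *: xs))
          + A^T *m (t *: (y0 + yb) + (1 - t) *: ys)
          + (t *: (x0 + zb) + (1 - t) *: zs),
      forall i, `|xb i 0| <= (1 - gap par) * rho par,
      forall i, `|zb i 0| <= (1 - gap par) * rho par &
      norm2 yb <= (lbA k)^-1 * (C_N par + ubQ k * rho par + rho par)].
Proof.
case=> _ _ _ [bt [ct [nbc sbc Ex Ez]]].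
have r0 := rho_gt0; case: (bq_cst H) => lA _ uQ _ _.
have [|xb [yb [zb [Axb Azb nxz]]]] :=
    @seminorm_witness _ _ _ P (lbA k) lA (bq_lbA H) bt ct ((1 - gap par) * rho par).
  apply: le_lt_trans sbc _; rewrite ltr_pM2r// /gap.
  by case: (bq_par H) => _ _ /andP[? ?] _ _; lra.
have nx := le_trans (norm2_le_col_mxl xb zb) (ltW nxz).
have nz := le_trans (norm2_le_col_mxr xb zb) (ltW nxz).
have gr : (1 - gap par) * rho par <= rho par by have := gap_gt0; nra.
exists xb, yb, zb; split.
- rewrite Ex -Axb /bbar -(bq_primal H) mu0E ?n_gt0//= !(mulmxDr, mulmxBr) -!scalemxAr.
  by rewrite mulmxDr; apply/colP => i; rewrite !mxE; ring.
- rewrite Ez -Azb /cbar -(bq_dual H) mu0E ?n_gt0//= !mulmxDr -!scalemxAr.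
  by rewrite !mulmxDr; apply/colP => i; rewrite !mxE; ring.
- by move=> i; apply: le_trans (entry_le_norm2 _ _) nx.
- by move=> i; apply: le_trans (entry_le_norm2 _ _) nz.
- apply: le_trans (dual_bound Azb) _; rewrite ler_pM2l ?invr_gt0//.
  have := norm2_le_col_mxr bt ct; have : ubQ k * norm2 xb <= ubQ k * rho par.
    by rewrite ler_wpM2l//; lra.
  by lra.
Qed.

Lemma norm2_y0 : norm2 y0 <= ub_y0 k * N.
Proof.
case: (bq_cst H) => _ _ _ _ uy; apply: le_trans (norm2_le_const (bq_y0_le H)) _.
by rewrite ler_wpM2l// ler_nat; case/andP: (bq_dim H).
Qed.

Lemma norm2_ys : norm2 ys <= ub_opt k * N.
Proof.
case: (bq_cst H) => _ _ _ us _; apply: le_trans (norm2_le_const (bq_ys_le H)) _.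
by rewrite ler_wpM2l// ler_nat; case/andP: (bq_dim H).
Qed.

Lemma norm2_reference (xb w : 'cV[R]_n) (t : R) : 0 <= t <= 1 ->
  (forall i, `|xb i 0| <= (1 - gap par) * rho par) ->
  (forall i, `|w i 0| <= ub_opt k) ->
  norm2 (t *: (x0 + xb) + (1 - t) *: w) <= c_refx par k * N.
Proof.
move=> /andP[t0 t1] xbr wu; apply: norm2_le_const => i; rewrite !mxE.
case: (bq_cst H) => _ _ _ us _; have r0 := rho_gt0; have g0 := gap_gt0.
apply: le_trans (ler_normD _ _) _; rewrite !normrM (ger0_norm t0).
have t1' : 0 <= 1 - t by rewrite subr_ge0.
rewrite (ger0_norm t1'); have := ler_normD (rho par) (xb i 0); rewrite (gtr0_norm r0) => n1.
have : t * `|rho par + xb i 0| <= `|rho par + xb i 0| by rewrite ler_piMl.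
have : (1 - t) * `|w i 0| <= `|w i 0| by rewrite ler_piMl//; lra.
have : 0 <= gap par * rho par by apply: mulr_ge0; exact: ltW.
have := xbr i; have := wu i; rewrite /c_refx; lra.
Qed.

Lemma ref_entry (e : R) : `|e| <= (1 - gap par) * rho par ->
  gap par * rho par <= rho par + e <= 2 * rho par.
Proof.
by have := rho_gt0; have := gap_gt0; rewrite ler_norml => g r /andP[? ?]; nra.
Qed.

(** Monotonicity at the difference between the iterate and the reference point (X, Y, Z). In the
    expansion of (x - X).(z - Z), the terms x.z and X.Z are O(t n), while x.Z and X.z dominate
    [t * gap * rho] times the sums of the entries of x and z. *)
Lemma iterate_energy zeta lambda x y z : let mu := mu_of x z in
  neighbourhood par P y0 mu zeta lambda x y z -> mu <= rho par ^+ 2 ->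
  exists (X : 'cV[R]_n) (Y : 'cV[R]_m) (Z : 'cV[R]_n),
  [/\ norm2 X <= c_refx par k * N, norm2 Y <= c_refy par k * N, norm2 Z <= c_refx par k * N,
      z - Z = Q *m (x - X) - A^T *m (y - Y) + mu *: (x - zeta) &
      gap par * rho par * (\sum_i x i 0 + \sum_i z i 0)
      + rho par ^+ 2 * (dot (y - Y) (y - lambda) + dot (x - X) (x - zeta))
        <= c_energy par k * N].
Proof.
move=> mu nb mu_le.
have [x_gt0 z_gt0 _ _] := nb; have mu_gt0 : 0 < mu by exact: mu_of_gt0.
have r0 := rho_gt0; have r2 : 0 < rho par ^+ 2 by rewrite exprn_gt0.
have g0 := gap_gt0; case: (bq_cst H) => lA _ uQ us uy.
have [xb [yb [zb /=]]] := neighbourhood_reference nb.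
set t := mu / _; have t0 : 0 < t by rewrite divr_gt0.
have t1 : t <= 1 by rewrite ler_pdivrMr// mul1r.
have mut : mu = t * rho par ^+ 2 by rewrite divfK// gt_eqF.
have t01 : 0 <= t <= 1 by rewrite ltW.
set X := t *: (x0 + xb) + _; set Y := t *: (y0 + yb) + _; set Z := t *: (x0 + zb) + _.
move=> [EX EZ xb_le zb_le yb_le].
have zE : z - Z = Q *m (x - X) - A^T *m (y - Y) + mu *: (x - zeta).
  move/colP: EZ => EZ; rewrite !mulmxBr; apply/colP => i.
  by have := EZ i; rewrite !mxE => EZi; lra.
have AE : A *m (x - X) = - (mu *: (y - lambda)).
  by rewrite mulmxBr -EX opprD addrA subrr sub0r.
exists X, Y, Z; split => //.
- by apply: norm2_reference => //; exact: (bq_xs_le H).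
- apply: le_trans (norm2D _ _) _; rewrite !norm2Z !ger0_norm ?(ltW t0) ?subr_ge0//.
  have := norm2D y0 yb; have := norm2_y0; have := norm2_ys; have := N_ge1.
  have := norm2_ge0 y0; have := norm2_ge0 yb; have := norm2_ge0 ys.
  have := norm2_ge0 (y0 + yb).
  have cb := yshift_ge0; move: yb_le; rewrite /c_refy; move: cb.
  move: (_^-1 * _) (norm2 (y0 + yb)) (norm2 y0) (norm2 yb) (norm2 ys).
  move=> e a1 a2 a3 a4 e0 a3e a10 a40 a30 a20 N1 a4u a2u a1D.
  have : t * a1 <= a1 by nra.
  have : (1 - t) * a4 <= a4 by nra.
  have : e <= e * N by nra.
  by lra.
- by apply: norm2_reference => //; exact: (bq_zs_le H).
have XE i : X i 0 = t * (rho par + xb i 0) + (1 - t) * xs i 0 by rewrite !mxE.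
have ZE i : Z i 0 = t * (rho par + zb i 0) + (1 - t) * zs i 0 by rewrite !mxE.
have XZ : dot X Z <= t * (4 * rho par ^+ 2 + 4 * rho par * ub_opt k) * N.
  (* The zero added on the right is (1 - t)^2 xs.zs, which cancels the only products without a
     factor [t]. *)
  rewrite -[leRHS]addr0 -(mulr0 ((1 - t) ^+ 2)) -(bq_compl H) /dot mulr_sumr.
  rewrite mulr_natr -[X in _ *+ X](card_ord n) -sumr_const -big_split.
  apply: ler_sum => i _ /=; rewrite XE ZE.
  have := ref_entry (xb_le i); have := ref_entry (zb_le i).
  have := bq_xs_ge0 H i; have := bq_zs_ge0 H i.
  have /(le_trans (ler_norm _)) := bq_xs_le H i.
  have /(le_trans (ler_norm _)) := bq_zs_le H i.
  move: (rho par + xb i 0) (rho par + zb i 0) (xs i 0) (zs i 0) => p q a b.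
  move=> bu au b0 a0 /andP[q0 qr] /andP[p0 pr].
  have gr : 0 <= gap par * rho par by apply: mulr_ge0; exact: ltW.
  have p0' : 0 <= p by lra.
  have q0' : 0 <= q by lra.
  have pq : p * q <= 4 * rho par ^+ 2 by nra.
  have pb : p * b + q * a <= 4 * rho par * ub_opt k by nra.
  have tpq : t * (t * (p * q)) <= t * (4 * rho par ^+ 2).
    by rewrite ler_pM2l//; apply: le_trans pq; rewrite ler_piMl// mulr_ge0.
  have tpb : t * ((1 - t) * (p * b + q * a)) <= t * (4 * rho par * ub_opt k).
    rewrite ler_pM2l//; apply: le_trans pb; rewrite ler_piMl//.
      by rewrite addr_ge0// mulr_ge0.
    by rewrite lerBlDr lerDl ltW.
  by lra.
have xZ : t * (gap par * rho par) * \sum_i x i 0 <= dot x Z.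
  rewrite mulr_sumr; apply: ler_sum => i _; rewrite mulrC ler_pM2l// ZE.
  have /andP[q0 _] := ref_entry (zb_le i); have := bq_zs_ge0 H i; nra.
have Xz : t * (gap par * rho par) * \sum_i z i 0 <= dot X z.
  rewrite mulr_sumr; apply: ler_sum => i _; rewrite ler_pM2r// XE.
  have /andP[q0 _] := ref_entry (xb_le i); have := bq_xs_ge0 H i; nra.
have xz : dot x z = N * (t * rho par ^+ 2) by rewrite dot_mu_of -/mu mut.
have := saddle_monotone (bq_psd H) AE zE.
have -> : dot (x - X) (z - Z) = dot x z - dot x Z - dot X z + dot X Z.
  by rewrite !(dotBl, dotBr); ring.
(* Every term carries the factor [t]; dividing by it leaves a bound independent of mu. *)
by rewrite {1}mut xz => ?; rewrite -(ler_pM2l t0) /c_energy; lra.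
Qed.

End IterateBounds.

(** Turns a proximal term into squared norms; the difference of the two sides is |a - d|^2 / 2. *)
Lemma dot_sub_ge (R : realType) n (a d : 'cV[R]_n) :
  (dot a a - dot d d) / 2 <= dot a (a - d).
Proof.
by have := dot_ge0 (a - d); rewrite !(dotBl, dotBr) (dotC d a); lra.
Qed.

(** Replaces the square root of [s] by the larger [1 + s], so that the constants stay free of square
    roots. *)
Lemma sqr_le_linear (R : realType) (a s N : R) : 0 <= s -> 0 <= N ->
  a ^+ 2 <= s * N ^+ 2 -> a <= (1 + s) * N.
Proof.
move=> s0 N0 aN; apply: sqr_le_pos; first by rewrite mulr_ge0// addr_ge0.
apply: le_trans aN _; rewrite exprMn ler_wpM2r ?sqr_ge0//; nra.
Qed.

(** * Size of the proximal points and distance of the iterates to them *)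

Section ProximalConstants.
Context {R : realType} (par : parameters R) (k : bounds R).

Definition c_sum : R := c_energy par k / (gap par * rho par).
Definition c_prox : R := c_sum + c_refy par k
  + (lbA k)^-1 * (ubQ k * (c_sum + c_refx par k) + (c_sum + c_refx par k)).
Definition c_prox_sq : R := c_energy par k
  + rho par ^+ 2 / 2 * ((c_prox + c_refx par k) ^+ 2 + (c_prox + c_refy par k) ^+ 2).
Definition c_iter : R := c_prox + c_refx par k + c_refy par k
  + (1 + 2 * c_prox_sq / rho par ^+ 2) + c_prox_sq / (gap par * rho par).

End ProximalConstants.

Section ProximalBounds.
Context {R : realType} {m n : nat} {par : parameters R} {k : bounds R}
  {P : qp R m n} {y0 : 'cV[R]_m} {xs : 'cV[R]_n} {ys : 'cV[R]_m} {zs : 'cV[R]_n}.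
Context (H : bounded_qp par k P y0 xs ys zs).
Local Notation A := (qpA P).
Local Notation Q := (qpQ P).
Local Notation N := (n%:R : R).

Lemma c_energy_ge0 : 0 <= c_energy par k.
Proof.
have r0 := rho_gt0 H; case: (bq_cst H) => _ _ _ us _.
by rewrite /c_energy addr_ge0// !mulr_ge0 ?sqr_ge0// ltW.
Qed.

Lemma gap_rho_gt0 : 0 < gap par * rho par.
Proof. by rewrite mulr_gt0 ?(gap_gt0 H) ?(rho_gt0 H). Qed.

Lemma c_sum_ge0 : 0 <= c_sum par k.
Proof. by rewrite divr_ge0 ?c_energy_ge0 ?ltW ?gap_rho_gt0. Qed.

Lemma c_prox_ge : [/\ 0 <= c_prox par k, c_sum par k <= c_prox par k & c_refy par k +
  (lbA k)^-1 * (ubQ k * (c_sum par k + c_refx par k)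
                + (c_sum par k + c_refx par k)) <= c_prox par k].
Proof.
have := c_sum_ge0; have := c_refx_ge0 H; have := c_refy_ge0 H.
case: (bq_cst H) => lA _ uQ _ _ Y0 X0 p0.
have : 0 <= (lbA k)^-1 * (ubQ k * (c_sum par k + c_refx par k)
    + (c_sum par k + c_refx par k)).
  have s0 : 0 <= c_sum par k + c_refx par k by exact: addr_ge0.
  by apply: mulr_ge0; [rewrite invr_ge0 ltW|rewrite addr_ge0// mulr_ge0].
by rewrite /c_prox => ?; split; lra.
Qed.

Lemma c_prox_sq_ge0 : 0 <= c_prox_sq par k.
Proof.
apply: addr_ge0; first exact: c_energy_ge0.
by apply: mulr_ge0; [rewrite divr_ge0 ?sqr_ge0|rewrite addr_ge0 ?sqr_ge0].
Qed.

Lemma c_iter_ge : [/\ 0 <= c_iter par k,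
  c_prox_sq par k / (gap par * rho par) <= c_iter par k &
  c_prox par k + c_refx par k + c_refy par k
  + (1 + 2 * c_prox_sq par k / rho par ^+ 2) <= c_iter par k].
Proof.
have [p2 _ _] := c_prox_ge; have := c_refx_ge0 H; have := c_refy_ge0 H.
have h1 : 0 <= c_prox_sq par k / (gap par * rho par).
  by rewrite divr_ge0 ?c_prox_sq_ge0 ?ltW ?gap_rho_gt0.
have h2 : 0 <= 2 * c_prox_sq par k / rho par ^+ 2.
  by rewrite divr_ge0 ?sqr_ge0// mulr_ge0 ?c_prox_sq_ge0.
by rewrite /c_iter => ? ?; split; lra.
Qed.

Lemma sum_gt0_entries (x : 'cV[R]_n) : (forall i, 0 < x i 0) ->
  norm2 x <= \sum_i x i 0 /\ 0 <= \sum_i x i 0.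
Proof.
move=> x0; split; last by apply: sumr_ge0 => i _; exact: ltW.
apply: le_trans (norm2_le_sum x) _.
by apply: ler_sum => i _; rewrite gtr0_norm.
Qed.

(** With the centre at the point itself, the proximal terms of [iterate_energy] vanish, which bounds
    the sums of entries of x and z by O(n); y follows from the dual equation. *)
Lemma proximal_bound x y z : neighbourhood par P y0 (mu_of x z) x y x y z ->
  mu_of x z <= rho par ^+ 2 -> norm2 x <= c_prox par k * N /\ norm2 y <= c_prox par k * N.
Proof.
move=> nb mu_le; have [x0 z0 _ _] := nb.
have [X [Y [Z [nX nY nZ E en]]]] := iterate_energy H nb mu_le.
have gr := gap_rho_gt0; have N1 := N_ge1 H.
have xz : \sum_i x i 0 + \sum_i z i 0 <= c_sum par k * N.
  rewrite /c_sum mulrAC ler_pdivlMr// mulrC; apply: le_trans en.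
  by rewrite lerDl !subrr !dot0r addr0 mulr0.
have [nx sx] := sum_gt0_entries x0; have [nz sz] := sum_gt0_entries z0.
have [p2 c12 c2Y] := c_prox_ge; case: (bq_cst H) => lA _ uQ _ _.
split.
  have : c_sum par k * N <= c_prox par k * N by rewrite ler_wpM2r//; lra.
  by lra.
have E0 : - (Q *m (x - X)) + A^T *m (y - Y) + (z - Z) = 0.
  rewrite E subrr scaler0 addr0; apply/colP => i; rewrite !mxE; ring.
have := dual_bound H E0.
rewrite norm20 add0r.
have nxX : norm2 (x - X) <= (c_sum par k + c_refx par k) * N.
  by have := norm2B x X; lra.
have nzZ : norm2 (z - Z) <= (c_sum par k + c_refx par k) * N.
  by have := norm2B z Z; lra.
move=> nyY.
have nyY' : norm2 (y - Y) <= (lbA k)^-1 *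
   (ubQ k * (c_sum par k + c_refx par k) + (c_sum par k + c_refx par k)) * N.
  apply: le_trans nyY _; rewrite -mulrA ler_pM2l ?invr_gt0// mulrDl -mulrA.
  by rewrite lerD// ler_wpM2l.
have := norm2D (y - Y) Y; rewrite subrK.
have : (c_refy par k +
  (lbA k)^-1 * (ubQ k * (c_sum par k + c_refx par k) + (c_sum par k + c_refx par k))) * N
   <= c_prox par k * N by rewrite ler_wpM2r//; lra.
by lra.
Qed.

(** By [dot_sub_ge], the proximal terms are at least half of |x - X|^2 + |y - Y|^2, minus half of
    |zeta - X|^2 + |lambda - Y|^2 = O(n^2). The energy is thus O(n^2): the sums of entries are
    O(n^2), but the distances, which enter squared, are O(n). *)
Lemma iterate_bound zeta lambda x y z :
  neighbourhood par P y0 (mu_of x z) zeta lambda x y z ->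
  mu_of x z <= rho par ^+ 2 ->
  norm2 zeta <= c_prox par k * N -> norm2 lambda <= c_prox par k * N ->
  [/\ norm2 (x - zeta) <= c_iter par k * N, norm2 (y - lambda) <= c_iter par k * N,
      \sum_i x i 0 <= c_iter par k * N ^+ 2 & \sum_i z i 0 <= c_iter par k * N ^+ 2].
Proof.
move=> nb mu_le nzeta nlambda; have [x0 z0 _ _] := nb.
have [X [Y [Z [nX nY nZ E en]]]] := iterate_energy H nb mu_le.
have gr := gap_rho_gt0; have N1 := N_ge1 H.
have r0 := rho_gt0 H; have r2 : 0 < rho par ^+ 2 by rewrite exprn_gt0.
have [nx sx] := sum_gt0_entries x0; have [nz sz] := sum_gt0_entries z0.
have [p4 c34 c24] := c_iter_ge; have p3 := c_prox_sq_ge0; have [p2 _ _] := c_prox_ge.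
have X0 := c_refx_ge0 H; have Y0 := c_refy_ge0 H; have p0 := c_energy_ge0.
have nv : norm2 (zeta - X) <= (c_prox par k + c_refx par k) * N.
  by have := norm2B zeta X; lra.
have nu : norm2 (lambda - Y) <= (c_prox par k + c_refy par k) * N.
  by have := norm2B lambda Y; lra.
have sv : dot (zeta - X) (zeta - X) <= (c_prox par k + c_refx par k) ^+ 2 * N ^+ 2.
  by rewrite -sqr_norm2 -exprMn lerXn2r// nnegrE ?norm2_ge0// mulr_ge0//; lra.
have su : dot (lambda - Y) (lambda - Y) <= (c_prox par k + c_refy par k) ^+ 2 * N ^+ 2.
  by rewrite -sqr_norm2 -exprMn lerXn2r// nnegrE ?norm2_ge0// mulr_ge0//; lra.
have := dot_sub_ge (x - X) (zeta - X); have := dot_sub_ge (y - Y) (lambda - Y).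
rewrite (_ : x - X - (zeta - X) = x - zeta); last by rewrite opprB addrA subrK.
rewrite (_ : y - Y - (lambda - Y) = y - lambda); last by rewrite opprB addrA subrK.
move=> ey ex.
have c0N : c_energy par k * N <= c_energy par k * N ^+ 2.
  by rewrite ler_wpM2l// expr2 ler_peMl//; lra.
have en' : gap par * rho par * (\sum_i x i 0 + \sum_i z i 0) + rho par ^+ 2 / 2 *
    (dot (x - X) (x - X) + dot (y - Y) (y - Y)) <= c_prox_sq par k * N ^+ 2.
  have : rho par ^+ 2 * ((dot (x - X) (x - X) + dot (y - Y) (y - Y)) / 2
      - (dot (zeta - X) (zeta - X) + dot (lambda - Y) (lambda - Y)) / 2)
      <= rho par ^+ 2 * (dot (y - Y) (y - lambda) + dot (x - X) (x - zeta)).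
    by rewrite ler_pM2l//; lra.
  have : rho par ^+ 2 / 2 *
        (dot (zeta - X) (zeta - X) + dot (lambda - Y) (lambda - Y))
      <= rho par ^+ 2 / 2 *
        ((c_prox par k + c_refx par k) ^+ 2 + (c_prox par k + c_refy par k) ^+ 2) * N ^+ 2.
    by rewrite -[leRHS]mulrA ler_pM2l ?divr_gt0// mulrDl lerD.
  by rewrite /c_prox_sq; lra.
have sq : dot (x - X) (x - X) + dot (y - Y) (y - Y)
    <= 2 * c_prox_sq par k / rho par ^+ 2 * N ^+ 2.
  rewrite mulrAC ler_pdivlMr//.
  have : 0 <= gap par * rho par * (\sum_i x i 0 + \sum_i z i 0).
    by rewrite mulr_ge0 ?addr_ge0// ltW.
  by lra.
have sx2 : \sum_i x i 0 + \sum_i z i 0 <= c_iter par k * N ^+ 2.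
  apply: (@le_trans _ _ (c_prox_sq par k / (gap par * rho par) * N ^+ 2)).
    rewrite mulrAC ler_pdivlMr// mulrC; apply: le_trans en'; rewrite lerDl.
    by rewrite mulr_ge0 ?addr_ge0 ?dot_ge0// divr_ge0// ltW.
  by rewrite ler_wpM2r// sqr_ge0.
have s0 : 0 <= 2 * c_prox_sq par k / rho par ^+ 2 by rewrite divr_ge0 ?sqr_ge0// mulr_ge0.
have N0 : 0 <= N by [].
have nxX : norm2 (x - X) <= (1 + 2 * c_prox_sq par k / rho par ^+ 2) * N.
  apply: sqr_le_linear => //; rewrite sqr_norm2.
  by have := dot_ge0 (y - Y); lra.
have nyY : norm2 (y - Y) <= (1 + 2 * c_prox_sq par k / rho par ^+ 2) * N.
  apply: sqr_le_linear => //; rewrite sqr_norm2.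
  by have := dot_ge0 (x - X); lra.
have c24N : (c_prox par k + c_refx par k + c_refy par k
    + (1 + 2 * c_prox_sq par k / rho par ^+ 2)) * N
  <= c_iter par k * N by rewrite ler_wpM2r.
have XN : 0 <= c_refx par k * N by rewrite mulr_ge0.
have YN : 0 <= c_refy par k * N by rewrite mulr_ge0.
split; [| |lra|lra].
  by have := norm2B (x - X) (zeta - X); rewrite opprB addrA subrK; lra.
by have := norm2B (y - Y) (lambda - Y); rewrite opprB addrA subrK; lra.
Qed.

End ProximalBounds.

(** * The Newton direction *)

Section NewtonConstants.
Context {R : realType} (par : parameters R) (k : bounds R).

Definition c_rhs : R := 3 * ((gamma_mu par)^-1 + 1
  + 2 * (c_refx par k ^+ 2 * c_iter par k ^+ 2 / (gamma_mu par * rho par ^+ 4))).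
Definition c_newton : R := c_rhs
  + ((c_iter par k + c_refx par k) ^+ 2 + (c_iter par k + c_refy par k) ^+ 2).
Definition c_dir : R := 2 * c_rhs + 2 * c_newton
  + (1 + c_newton + c_refx par k + c_refy par k).

End NewtonConstants.

(** One row of the complementarity equation, with [X], [Z] the entries of the shifted direction. The
    left side is (z X + x Z)^2 / (x z); the numerator is bounded by (p + q + r)^2 <= 3 (p^2 + q^2 +
    r^2), and [x * z >= gamma * mu] handles the denominator. *)
Lemma scaled_newton_row (R : realType) (x z mu gamma sigma e X Z x' z' : R) :
  0 < x -> 0 < z -> 0 < mu -> 0 < gamma -> gamma * mu <= x * z ->
  0 <= sigma <= 1 -> `|x'| <= e -> `|z'| <= e ->
  z * X + x * Z = - (x * z) + sigma * mu + z * x' + x * z' ->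
  z / x * X ^+ 2 + x / z * Z ^+ 2 + 2 * (X * Z)
  <= 3 * (mu / gamma + x * z + e ^+ 2 / (gamma * mu) * (z ^+ 2 + x ^+ 2)).
Proof.
move=> x0 z0 mu0 g0 gm /andP[s0 s1] x'e z'e E.
have xz0 : 0 < x * z by rewrite mulr_gt0.
have gm0 : 0 < gamma * mu by rewrite mulr_gt0.
have -> : z / x * X ^+ 2 + x / z * Z ^+ 2 + 2 * (X * Z)
    = (z * X + x * Z) ^+ 2 / (x * z) by field; rewrite !gt_eqF.
have x'2 : x' ^+ 2 <= e ^+ 2
  by rewrite -real_normK ?num_real// lerXn2r// nnegrE ?(le_trans _ x'e).
have z'2 : z' ^+ 2 <= e ^+ 2
  by rewrite -real_normK ?num_real// lerXn2r// nnegrE ?(le_trans _ z'e).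
have sm : (sigma * mu - x * z) ^+ 2 <= mu ^+ 2 + (x * z) ^+ 2.
  have : 0 <= sigma * mu * (x * z) by rewrite !mulr_ge0// ltW.
  have : (sigma * mu) ^+ 2 <= mu ^+ 2.
    by rewrite lerXn2r ?nnegrE ?mulr_ge0 ?(ltW mu0)// ler_piMl// ltW.
  by lra.
have h : (z * X + x * Z) ^+ 2 <=
    3 * (mu ^+ 2 + (x * z) ^+ 2 + e ^+ 2 * (z ^+ 2 + x ^+ 2)).
  rewrite E; set p := sigma * mu - x * z.
  have : z ^+ 2 * x' ^+ 2 <= z ^+ 2 * e ^+ 2 by rewrite ler_wpM2l ?sqr_ge0.
  have : x ^+ 2 * z' ^+ 2 <= x ^+ 2 * e ^+ 2 by rewrite ler_wpM2l ?sqr_ge0.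
  have := sqr_ge0 (p - z * x'); have := sqr_ge0 (p - x * z').
  have := sqr_ge0 (z * x' - x * z'); rewrite -/p in sm.
  have -> : - (x * z) + sigma * mu + z * x' + x * z' = p + z * x' + x * z'.
    by rewrite /p; ring.
  by rewrite !expr2 in sm *; clearbody p; lra.
rewrite ler_pdivrMr//; apply: le_trans h _; rewrite -[leRHS]mulrA ler_pM2l ?ltr0n//.
have h1 : mu ^+ 2 <= mu / gamma * (x * z).
  rewrite [leRHS](_ : _ = mu * (x * z / gamma)); last by ring.
  by rewrite expr2 ler_pM2l// ler_pdivlMr// mulrC.
have h2 : e ^+ 2 * (z ^+ 2 + x ^+ 2) <=
    e ^+ 2 / (gamma * mu) * (z ^+ 2 + x ^+ 2) * (x * z).
  rewrite [leRHS](_ : _ = e ^+ 2 * (z ^+ 2 + x ^+ 2) * ((x * z) / (gamma * mu))).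
    apply: ler_peMr; last by rewrite ler_pdivlMr// mul1r.
    by apply: mulr_ge0; rewrite ?addr_ge0 ?sqr_ge0.
  by ring.
by rewrite expr2 in h1; lra.
Qed.

Section NewtonBounds.
Context {R : realType} {m n : nat} {par : parameters R} {k : bounds R}
  {P : qp R m n} {y0 : 'cV[R]_m} {xs : 'cV[R]_n} {ys : 'cV[R]_m} {zs : 'cV[R]_n}.
Context (H : bounded_qp par k P y0 xs ys zs).
Local Notation A := (qpA P).
Local Notation Q := (qpQ P).
Local Notation N := (n%:R : R).
Local Notation x0 := (const_mx (rho par) : 'cV[R]_n).
Local Notation gamma := (gamma_mu par).

Lemma gamma_mu01 : 0 < gamma < 1.
Proof. by case: (bq_par H). Qed.

Lemma newton_direction_rows zeta lambda x y z sigma dx dy dz :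
  newton_direction par P y0 (Iterate x y z zeta lambda) sigma dx dy dz ->
  forall i, z i 0 * dx i 0 + x i 0 * dz i 0
    = - (x i 0 * z i 0) + sigma * mu_of x z.
Proof.
move=> [_ _ /colP E] i; have := E i.
by rewrite -mulmxA !mul_diag_mx !mxE !mulr1.
Qed.

(* [dx + x'] solves a homogeneous system up to the proximal terms. *)
Lemma newton_homogeneous zeta lambda x y z sigma dx dy dz :
  let mu := mu_of x z in let t := mu / rho par ^+ 2 in
  neighbourhood par P y0 mu zeta lambda x y z -> mu <= rho par ^+ 2 ->
  0 <= sigma <= 1 ->
  newton_direction par P y0 (Iterate x y z zeta lambda) sigma dx dy dz ->
  exists (x' : 'cV[R]_n) (y' : 'cV[R]_m) (z' : 'cV[R]_n),
  [/\ A *m (dx + x') = - (mu *: (dy - (1 - sigma) *: (y - lambda))),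
      dz + z' = Q *m (dx + x') - A^T *m (dy + y')
        + mu *: (dx - (1 - sigma) *: (x - zeta)),
      forall i, `|x' i 0| <= t * c_refx par k, forall i, `|z' i 0| <= t * c_refx par k &
      norm2 y' <= c_refy par k * N].
Proof.
move=> mu t nb mu_le /andP[s0 s1] [N1 N2 _].
have [x_gt0 z_gt0 _ _] := nb; have mu_gt0 : 0 < mu by exact: (mu_of_gt0 H).
have r0 := rho_gt0 H; have r2 : 0 < rho par ^+ 2 by rewrite exprn_gt0.
have [xb [yb [zb /=]]] := neighbourhood_reference H nb; rewrite -/t.
have t0 : 0 <= t by rewrite divr_ge0// ltW.
have t1 : t <= 1 by rewrite ler_pdivrMr// mul1r.
move=> [EX EZ xb_le zb_le yb_le].
have g0 := gap_gt0 H; case: (bq_cst H) => lA _ uQ us uy.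
have tsig : sigma * mu / rho par ^+ 2 = sigma * t by rewrite -mulrA.
(* The Newton equations lower the multiple of the initial residual from [t] to [sigma * t] and
   remove the perturbation altogether. The shift therefore takes [(1 - sigma) * t] of the starting
   point minus the optimal solution, and [t] of the preimage of the perturbation. *)
pose s' := (1 - sigma) * t; have s'E : s' = (1 - sigma) * t by [].
have s'0 : 0 <= s' by rewrite mulr_ge0// subr_ge0.
have s't : s' <= t by rewrite ler_piMl// lerBlDr lerDl.
clearbody t s'.
exists (s' *: (x0 - xs) + t *: xb), (s' *: (y0 - ys) + t *: yb),
  (s' *: (x0 - zs) + t *: zb).
have entry (b w : 'cV[R]_n) i : `|b i 0| <= (1 - gap par) * rho par ->
    `|w i 0| <= ub_opt k -> `|(s' *: (x0 - w) + t *: b) i 0| <= t * c_refx par k.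
  move=> bi wi; rewrite !mxE; apply: le_trans (ler_normD _ _) _.
  rewrite !normrM (ger0_norm t0) (ger0_norm s'0).
  have := ler_normB (rho par) (w i 0); rewrite (gtr0_norm r0) => rw.
  have : s' * `|rho par - w i 0| <= t * (rho par + ub_opt k).
    by apply: ler_pM => //; lra.
  have : t * `|b i 0| <= t * rho par.
    by rewrite ler_wpM2l//; apply: le_trans bi _; rewrite ler_piMl ?(ltW r0)//; lra.
  by rewrite /c_refx; lra.
split.
- move: N2; rewrite /= mu0E ?(n_gt0 H)// /bbar -(bq_primal H) /Defs.mu /= -/mu tsig.
  move: EX; rewrite !(mulmxDr, mulmxN) -!scalemxAr !(mulmxDr, mulmxN).
  move=> /colP E1 /colP E2; apply/colP => i; have := E1 i; have := E2 i; clearbody mu.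
  by rewrite !mxE s'E => e1 e2; lra.
- move: N1; rewrite /= mu0E ?(n_gt0 H)// /cbar -(bq_dual H) /Defs.mu /= -/mu tsig.
  move: EZ; rewrite mulmxDl mul_scalar_mx !(mulmxDr, mulmxN) -!scalemxAr !(mulmxDr, mulmxN).
  move=> /colP E1 /colP E2; apply/colP => i; have := E1 i; have := E2 i; clearbody mu.
  by rewrite !mxE s'E => e1 e2; lra.
- by move=> i; apply: entry => //; exact: (bq_xs_le H).
- by move=> i; apply: entry => //; exact: (bq_zs_le H).
have e0 := yshift_ge0 H; have ny := norm2_y0 H; have nys := norm2_ys H.
have K1 := N_ge1 H.
apply: le_trans (norm2D _ _) _; rewrite !norm2Z (ger0_norm t0) (ger0_norm s'0).
have nB := norm2B y0 ys.
have : s' * norm2 (y0 - ys) <= norm2 (y0 - ys).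
  by rewrite ler_piMl ?norm2_ge0// (le_trans s't).
have : t * norm2 yb <= norm2 yb by rewrite ler_piMl ?norm2_ge0.
move: e0 yb_le; rewrite /c_refy; move: (_^-1 * _) => e e0 yb_le.
have : e <= e * N by rewrite ler_peMr.
by lra.
Qed.

Lemma gamma_gt0 : 0 < gamma. Proof. by case/andP: gamma_mu01. Qed.

Lemma c_rhs_ge : 0 <= c_rhs par k /\
  c_refx par k ^+ 2 * c_iter par k ^+ 2 / (gamma * rho par ^+ 4) <= c_rhs par k.
Proof.
have g0 := gamma_gt0; have r0 := rho_gt0 H.
have h : 0 <= c_refx par k ^+ 2 * c_iter par k ^+ 2 / (gamma * rho par ^+ 4).
  apply: divr_ge0; first by rewrite mulr_ge0 ?sqr_ge0.
  by rewrite mulr_ge0 ?exprn_ge0 ?(ltW g0) ?(ltW r0).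
have gi : 0 < gamma^-1 by rewrite invr_gt0.
by rewrite /c_rhs; split; lra.
Qed.

Lemma c_newton_ge0 : 0 <= c_newton par k.
Proof. by rewrite /c_newton !addr_ge0 ?sqr_ge0//; case: c_rhs_ge. Qed.

Lemma c_dir_ge : [/\ 2 * c_newton par k + 2 * c_rhs par k <= c_dir par k,
  1 + c_newton par k + c_refx par k <= c_dir par k &
  1 + c_newton par k + c_refy par k <= c_dir par k].
Proof.
have [c50 _] := c_rhs_ge; have := c_newton_ge0; have := c_refx_ge0 H; have := c_refy_ge0 H.
by rewrite /c_dir => *; split; lra.
Qed.

Lemma sum_sqr_le (x : 'cV[R]_n) B : (forall i, 0 < x i 0) ->
  \sum_i x i 0 <= B -> \sum_i x i 0 ^+ 2 <= B ^+ 2.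
Proof.
move=> x_gt0 xB; have [nx sx] := sum_gt0_entries x_gt0.
have -> : \sum_i x i 0 ^+ 2 = norm2 x ^+ 2.
  by rewrite sqr_norm2; apply: eq_bigr => i _; rewrite expr2.
by rewrite lerXn2r ?nnegrE ?norm2_ge0 ?(le_trans sx)// (le_trans nx).
Qed.

(** The weight z / x equals z^2 / (x z), whose denominator is at least [gamma * mu]. *)
Lemma scaled_shift_le (x z x' : 'cV[R]_n) (mu e : R) :
  (forall i, 0 < x i 0) -> (forall i, 0 < z i 0) -> 0 < mu ->
  (forall i, gamma * mu <= x i 0 * z i 0) -> (forall i, `|x' i 0| <= e) ->
  \sum_i z i 0 / x i 0 * x' i 0 ^+ 2
  <= e ^+ 2 / (gamma * mu) * \sum_i z i 0 ^+ 2.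
Proof.
move=> x_gt0 z_gt0 mu0 gm x'e; rewrite mulr_sumr; apply: ler_sum => i _.
have xz : 0 < x i 0 * z i 0 by rewrite mulr_gt0.
have gm0 : 0 < gamma * mu by rewrite mulr_gt0// gamma_gt0.
have -> : z i 0 / x i 0 * x' i 0 ^+ 2 = x' i 0 ^+ 2 / (x i 0 * z i 0) * z i 0 ^+ 2.
  by field; rewrite !gt_eqF.
rewrite ler_wpM2r ?sqr_ge0//; apply: ler_pM; rewrite ?sqr_ge0 ?invr_ge0 ?(ltW xz)//.
  by rewrite -real_normK ?num_real// lerXn2r// nnegrE ?(le_trans _ (x'e i)).
by rewrite lef_pV2.
Qed.

Lemma weighted_sub_le (a : 'I_n -> R) (d d' : 'cV[R]_n) B B' :
  (forall i, 0 <= a i) -> \sum_i a i * (d + d') i 0 ^+ 2 <= B ->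
  \sum_i a i * d' i 0 ^+ 2 <= B' ->
  \sum_i a i * d i 0 ^+ 2 <= 2 * B + 2 * B'.
Proof.
move=> a0 dB d'B; apply: (@le_trans _ _ (2 * (\sum_i a i * (d + d') i 0 ^+ 2)
    + 2 * (\sum_i a i * d' i 0 ^+ 2))); last by lra.
rewrite !mulr_sumr -big_split; apply: ler_sum => i _ /=; rewrite mxE.
have : 0 <= a i * (d i 0 + 2 * d' i 0) ^+ 2 by rewrite mulr_ge0 ?sqr_ge0.
by rewrite !expr2; lra.
Qed.

End NewtonBounds.

Section NewtonDirection.
Context {R : realType} {m n : nat} {par : parameters R} {k : bounds R}
  {P : qp R m n} {y0 : 'cV[R]_m} {xs : 'cV[R]_n} {ys : 'cV[R]_m} {zs : 'cV[R]_n}.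
Context (H : bounded_qp par k P y0 xs ys zs).
Local Notation A := (qpA P).
Local Notation Q := (qpQ P).
Local Notation N := (n%:R : R).
Local Notation gamma := (gamma_mu par).

(** Summing [scaled_newton_row] bounds |D^-1 (dx + x')|^2 + |D (dz + z')|^2 + 2 (dx + x').(dz + z'),
    where D^2 = X Z^-1, by O(mu n^4); the power 4 comes from squaring the O(n^2) sums of entries.
    Monotonicity bounds the inner product below by half of mu (|dx + x'|^2 + |dy + y'|^2), up to
    O(mu n^2). *)
Lemma newton_energy zeta lambda x y z sigma dx dy dz :
  let mu := mu_of x z in
  neighbourhood par P y0 mu zeta lambda x y z -> mu <= rho par ^+ 2 ->
  norm2 (x - zeta) <= c_iter par k * N -> norm2 (y - lambda) <= c_iter par k * N ->
  \sum_i x i 0 <= c_iter par k * N ^+ 2 -> \sum_i z i 0 <= c_iter par k * N ^+ 2 ->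
  0 <= sigma <= 1 ->
  newton_direction par P y0 (Iterate x y z zeta lambda) sigma dx dy dz ->
  exists (x' : 'cV[R]_n) (y' : 'cV[R]_m) (z' : 'cV[R]_n),
  [/\ norm2 x' <= c_refx par k * N, norm2 y' <= c_refy par k * N,
      \sum_i z i 0 / x i 0 * x' i 0 ^+ 2 <= c_rhs par k * (mu * N ^+ 4),
      \sum_i x i 0 / z i 0 * z' i 0 ^+ 2 <= c_rhs par k * (mu * N ^+ 4) &
      \sum_i z i 0 / x i 0 * (dx + x') i 0 ^+ 2
      + \sum_i x i 0 / z i 0 * (dz + z') i 0 ^+ 2
      + mu * (dot (dx + x') (dx + x') + dot (dy + y') (dy + y'))
        <= c_newton par k * (mu * N ^+ 4)].
Proof.
move=> mu nb mu_le nxz nyl sx sz s01 nd.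
have [x_gt0 z_gt0 gm _] := nb; have mu_gt0 : 0 < mu by exact: (mu_of_gt0 H).
have [x' [y' [z' [AE zE x'e z'e ny']]]] := newton_homogeneous H nb mu_le s01 nd.
rewrite -/mu in AE zE x'e z'e gm; set t := mu / _ in x'e z'e.
have g0 := gamma_gt0 H; have g1 : gamma < 1 by case/andP: (gamma_mu01 H).
have r0 := rho_gt0 H; have r2 : 0 < rho par ^+ 2 by rewrite exprn_gt0.
have t0 : 0 <= t by rewrite divr_ge0// ltW.
have t1 : t <= 1 by rewrite ler_pdivrMr// mul1r.
have N1 := N_ge1 H; have N0 : 0 <= N by [].
have N24 : N ^+ 2 <= N ^+ 4 by rewrite ler_weXn2l.
have N14 : N <= N ^+ 4 by rewrite -[leLHS]expr1 ler_weXn2l.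
have N12 : N <= N ^+ 2 by rewrite -[leLHS]expr1 ler_weXn2l.
have [c50 c5g] := c_rhs_ge H; have c60 := c_newton_ge0 H.
have X0 := c_refx_ge0 H; have Y0 := c_refy_ge0 H; have [c40 _ _] := c_iter_ge H.
(* The shift is proportional to mu, so its square divided by [gamma * mu] is again proportional to
   mu. *)
have e2 : (t * c_refx par k) ^+ 2 / (gamma * mu)
    = mu * (c_refx par k ^+ 2 / (gamma * rho par ^+ 4)).
  by rewrite /t; field; rewrite !gt_eqF.
have x2 := sum_sqr_le x_gt0 sx; have z2 := sum_sqr_le z_gt0 sz.
have w0 : 0 <= c_refx par k ^+ 2 / (gamma * rho par ^+ 4).
  by rewrite divr_ge0 ?sqr_ge0// mulr_ge0 ?exprn_ge0 ?(ltW g0) ?(ltW r0).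
have shift (v : R) : v <= (c_iter par k * N ^+ 2) ^+ 2 ->
    (t * c_refx par k) ^+ 2 / (gamma * mu) * v
    <= c_refx par k ^+ 2 * c_iter par k ^+ 2 / (gamma * rho par ^+ 4) * (mu * N ^+ 4).
  move=> vB; rewrite e2.
  rewrite [leRHS](_ : _ = mu * (c_refx par k ^+ 2 / (gamma * rho par ^+ 4)) *
     (c_iter par k * N ^+ 2) ^+ 2); last by ring.
  by apply: ler_wpM2l => //; rewrite mulr_ge0// ltW.
have muN : 0 <= mu * N ^+ 4 by rewrite mulr_ge0 ?exprn_ge0// ltW.
have shift' (v d' : 'cV[R]_n) : (forall i, `|d' i 0| <= t * c_refx par k) ->
  \sum_i v i 0 ^+ 2 <= (c_iter par k * N ^+ 2) ^+ 2 -> forall w : 'cV[R]_n,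
  (forall i, 0 < v i 0) -> (forall i, 0 < w i 0) ->
  (forall i, gamma * mu <= w i 0 * v i 0) ->
  \sum_i v i 0 / w i 0 * d' i 0 ^+ 2 <= c_rhs par k * (mu * N ^+ 4).
  move=> d'e v2 w v_gt0 w_gt0 gm'.
  apply: le_trans (scaled_shift_le H w_gt0 v_gt0 mu_gt0 gm' d'e) _.
  by apply: le_trans (shift _ v2) _; rewrite ler_wpM2r.
have rows i := newton_direction_rows nd i.
have : \sum_i (z i 0 / x i 0 * (dx + x') i 0 ^+ 2 + x i 0 / z i 0 * (dz + z') i 0 ^+ 2
    + 2 * ((dx + x') i 0 * (dz + z') i 0)) <= c_rhs par k * mu * N ^+ 4.
  apply: le_trans (ler_sum _ (fun i _ => scaled_newton_row (x_gt0 i) (z_gt0 i)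
    mu_gt0 g0 (gm i) s01 (x'e i) (z'e i) _)) _.
    move=> i _; have := rows i; rewrite !mxE => E.
    by rewrite !mulrDr addrACA E addrA.
  rewrite -mulr_sumr !big_split /=.
  rewrite -[\sum_(i < n) x i 0 * z i 0]/(dot x z) (dot_mu_of H) -/mu.
  rewrite sumr_const card_ord -[_ *+ n]mulr_natr.
  rewrite (_ : \sum_i _ * (_ + _) = (t * c_refx par k) ^+ 2 / (gamma * mu) *
    (\sum_i z i 0 ^+ 2) + (t * c_refx par k) ^+ 2 / (gamma * mu) * (\sum_i x i 0 ^+ 2)).
    2: by rewrite -mulrDr -big_split mulr_sumr.
  have := shift _ x2; have := shift _ z2.
  have : mu / gamma * N <= mu / gamma * N ^+ 4.
    by rewrite ler_pM2l// divr_gt0.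
  have : N * mu <= N ^+ 4 * mu by rewrite ler_pM2r.
  by rewrite /c_rhs; lra.
rewrite big_split big_split /= -mulr_sumr.
rewrite -[\sum_i (dx + x') i 0 * _]/(dot (dx + x') (dz + z')).
have := saddle_monotone (bq_psd H) AE zE.
(* [dot_sub_ge] applies because [d - (1 - sigma) *: a] is [d + v] minus [(1 - sigma) *: a + v], and
   the latter vector is O(n). *)
have prox p (d a v : 'cV[R]_p) c : norm2 a <= c_iter par k * N -> norm2 v <= c * N ->
    (dot (d + v) (d + v) - (c_iter par k + c) ^+ 2 * N ^+ 2) / 2
    <= dot (d + v) (d - (1 - sigma) *: a).
  move=> na nv; have := dot_sub_ge (d + v) ((1 - sigma) *: a + v).
  rewrite (_ : d + v - ((1 - sigma) *: a + v) = d - (1 - sigma) *: a); last first.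
    by rewrite opprD addrACA subrr addr0.
  have : dot ((1 - sigma) *: a + v) ((1 - sigma) *: a + v)
      <= (c_iter par k + c) ^+ 2 * N ^+ 2.
    have n_le : norm2 ((1 - sigma) *: a + v) <= (c_iter par k + c) * N.
      apply: le_trans (norm2D _ _) _; rewrite norm2Z mulrDl lerD//.
      apply: le_trans na; rewrite ler_piMl ?norm2_ge0// ger0_norm ?subr_ge0.
        by case/andP: s01 => s0 _; rewrite lerBlDr lerDl.
      by case/andP: s01.
    rewrite -sqr_norm2 -exprMn lerXn2r// nnegrE ?norm2_ge0//.
    by apply: le_trans n_le; exact: norm2_ge0.
  by lra.
have nx' : norm2 x' <= c_refx par k * N.
  apply: le_trans (norm2_le_const x'e) _; rewrite ler_wpM2r//.
  by rewrite ler_piMl.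
have px := prox _ dx _ _ _ nxz nx'; have py := prox _ dy _ _ _ nyl ny'.
move=> sad energy.
have {px py}sad : mu / 2 * (dot (dx + x') (dx + x') + dot (dy + y') (dy + y')
    - ((c_iter par k + c_refx par k) ^+ 2 + (c_iter par k + c_refy par k) ^+ 2) * N ^+ 2)
    <= dot (dx + x') (dz + z').
  apply: le_trans sad; rewrite -mulrA ler_pM2l//; lra.
exists x', y', z'; split=> //.
- exact: (shift' z x' x'e z2).
- by apply: (shift' x z' z'e x2) => // i; rewrite [leRHS]mulrC.
have : mu * ((c_iter par k + c_refx par k) ^+ 2
      + (c_iter par k + c_refy par k) ^+ 2) * N ^+ 2 <=
    mu * ((c_iter par k + c_refx par k) ^+ 2
      + (c_iter par k + c_refy par k) ^+ 2) * N ^+ 4.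
  by rewrite ler_wpM2l// mulr_ge0 ?(ltW mu_gt0)// addr_ge0 ?sqr_ge0.
rewrite /c_newton; lra.
Qed.

(** Removes the shifts from [newton_energy]. The unweighted bounds on dx and dy come from its
    proximal part, divided by mu. *)
Lemma newton_bound zeta lambda x y z sigma dx dy dz :
  let mu := mu_of x z in
  neighbourhood par P y0 mu zeta lambda x y z -> mu <= rho par ^+ 2 ->
  norm2 (x - zeta) <= c_iter par k * N -> norm2 (y - lambda) <= c_iter par k * N ->
  \sum_i x i 0 <= c_iter par k * N ^+ 2 -> \sum_i z i 0 <= c_iter par k * N ^+ 2 ->
  0 <= sigma <= 1 ->
  newton_direction par P y0 (Iterate x y z zeta lambda) sigma dx dy dz ->
  [/\ \sum_i z i 0 / x i 0 * dx i 0 ^+ 2 <= c_dir par k * mu * N ^+ 4,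
      \sum_i x i 0 / z i 0 * dz i 0 ^+ 2 <= c_dir par k * mu * N ^+ 4,
      norm2 dx <= c_dir par k * N ^+ 2 & norm2 dy <= c_dir par k * N ^+ 2].
Proof.
move=> mu nb mu_le nxz nyl sx sz s01 nd.
have [x' [y' [z' [nx' ny' hx hz total]]]] := newton_energy nb mu_le nxz nyl sx sz s01 nd.
rewrite -/mu in hx hz total.
have [x_gt0 z_gt0 _ _] := nb; have mu_gt0 : 0 < mu by exact: (mu_of_gt0 H).
have N1 := N_ge1 H; have N0 : 0 <= N by [].
have N12 : N <= N ^+ 2 by rewrite -[leLHS]expr1 ler_weXn2l.
have muN : 0 <= mu * N ^+ 4 by rewrite mulr_ge0 ?exprn_ge0// ltW.
have [c57 c7X c7Y] := c_dir_ge H; have c60 := c_newton_ge0 H.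
have sx0 : 0 <= \sum_i z i 0 / x i 0 * (dx + x') i 0 ^+ 2.
  by apply: sumr_ge0 => i _; rewrite mulr_ge0 ?sqr_ge0// divr_ge0// ltW.
have sz0 : 0 <= \sum_i x i 0 / z i 0 * (dz + z') i 0 ^+ 2.
  by apply: sumr_ge0 => i _; rewrite mulr_ge0 ?sqr_ge0// divr_ge0// ltW.
have d0 := dot_ge0 (dx + x'); have d0' := dot_ge0 (dy + y').
have md0 : 0 <= mu * (dot (dx + x') (dx + x') + dot (dy + y') (dy + y')).
  by rewrite mulr_ge0 ?addr_ge0// ltW.
have scaled (a : 'I_n -> R) (d d' : 'cV[R]_n) : (forall i, 0 <= a i) ->
    \sum_i a i * (d + d') i 0 ^+ 2 <= c_newton par k * (mu * N ^+ 4) ->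
    \sum_i a i * d' i 0 ^+ 2 <= c_rhs par k * (mu * N ^+ 4) ->
    \sum_i a i * d i 0 ^+ 2 <= c_dir par k * mu * N ^+ 4.
  move=> a0 B B'; apply: le_trans (weighted_sub_le a0 B B') _.
  by have := ler_wpM2r muN c57; lra.
have direction p (d v : 'cV[R]_p) c : dot (d + v) (d + v) <= c_newton par k * N ^+ 4 ->
    norm2 v <= c * N -> 0 <= c -> 1 + c_newton par k + c <= c_dir par k ->
    norm2 d <= c_dir par k * N ^+ 2.
  move=> dv nv c_ge0 c_le.
  have : norm2 (d + v) <= (1 + c_newton par k) * N ^+ 2.
    by apply: sqr_le_linear; rewrite ?sqr_ge0// sqr_norm2 -exprM.
  have := norm2B (d + v) v; rewrite addrK.
  have : c * N <= c * N ^+ 2 by rewrite ler_wpM2l.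
  have : (1 + c_newton par k + c) * N ^+ 2 <= c_dir par k * N ^+ 2.
    by rewrite ler_wpM2r// sqr_ge0.
  by lra.
split.
- apply: scaled hx; first by move=> i; rewrite divr_ge0// ltW.
  by move: total sz0 md0 => /=; lra.
- apply: scaled hz; first by move=> i; rewrite divr_ge0// ltW.
  by move: total sx0 md0 => /=; lra.
- apply: direction nx' (c_refx_ge0 H) c7X; rewrite -(ler_pM2l mu_gt0).
  have := mulr_ge0 (ltW mu_gt0) d0'.
  by move: total sx0 sz0; lra.
- apply: direction ny' (c_refy_ge0 H) c7Y; rewrite -(ler_pM2l mu_gt0).
  have := mulr_ge0 (ltW mu_gt0) d0.
  by move: total sx0 sz0; lra.
Qed.

End NewtonDirection.

(** * The step length *)

Section StepConstants.
Context {R : realType} (par : parameters R) (k : bounds R).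

Definition c_start : R :=
  ubA k * c_refx par k + ubQ k * c_refx par k + ubA k * c_refy par k + c_refx par k.
Definition c_res : R :=
  c_dir par k * (c_iter par k + c_start / rho par ^+ 2) + 2 * c_dir par k.
Definition c_semi : R := (lbA k)^-1 * (1 + ubQ k) + 1.
(** The inverse of a sum of positive thresholds is below the inverse of each: the summands ensure,
    in order, the five conclusions of [step_factorP], and the presence of the others makes the third
    one strict. *)
Definition step_factor : R :=
  (1 + 2 * c_dir par k / ((1 - gamma_mu par) * sigma_min par)
   + (1 + c_dir par k / gamma_mu par)
   + 4 * c_res * rho par ^+ 2 / (C_N par * sigma_min par)
   + 4 * c_res * rho par ^+ 2 * c_semi / (gamma_A par * rho par * sigma_min par))^-1.

End StepConstants.

(** The second-order term is at most half of [a * sigma * mu]. With [sigma <= 1/2] this leaves a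
    decrease of at least [a / 4 * mu], more than required. *)
Lemma step_mu_bounds (R : realType) (mu a sigma smin delta mua : R) :
  0 < mu -> 0 < a -> smin <= sigma <= 2^-1 -> a * `|delta| <= smin / 2 * mu ->
  mua = (1 - a * (1 - sigma)) * mu + a ^+ 2 * delta ->
  (1 - a) * mu + a * (sigma * mu / 2) <= mua <= (1 - a / 100) * mu.
Proof.
move=> mu0 a0 /andP[ss s2] ad ->.
have := ler_norm delta; have := ler_norm (- delta); rewrite normrN => d1 d2.
have lo : - (a * (smin / 2 * mu)) <= a ^+ 2 * delta.
  rewrite lerNl -mulrN expr2 -[a * a * _]mulrA ler_pM2l//.
  by apply: le_trans ad; rewrite ler_pM2l.
have hi : a ^+ 2 * delta <= a * (smin / 2 * mu).
  by rewrite expr2 -[a * a * _]mulrA ler_pM2l//; apply: le_trans ad; rewrite ler_pM2l.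
have am0 : 0 < a * mu by rewrite mulr_gt0.
have : a * mu * smin <= a * mu * sigma by rewrite ler_pM2l.
have : a * mu * sigma <= a * mu * 2^-1 by rewrite ler_pM2l.
by move=> h1 h2; apply/andP; split; lra.
Qed.

(** To first order the product exceeds [gamma] times the new mu by at least
    [a * (1 - gamma) * sigma * mu]; each of the two second-order terms uses at most half of it. *)
Lemma step_centrality (R : realType) (mu a gamma sigma smin delta mua x z dx dz : R) :
  0 < mu -> 0 < a <= 1 -> 0 < gamma < 1 -> 0 < smin <= sigma ->
  a * `|delta| <= (1 - gamma) * smin / 2 * mu ->
  a * `|dx * dz| <= (1 - gamma) * smin / 2 * mu ->
  mua = (1 - a * (1 - sigma)) * mu + a ^+ 2 * delta ->
  gamma * mu <= x * z -> z * dx + x * dz = - (x * z) + sigma * mu ->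
  gamma * mua <= (x + a * dx) * (z + a * dz).
Proof.
move=> mu0 /andP[a0 a1] /andP[g0 g1] /andP[s0 ss] ad axz -> gm row.
have -> : (x + a * dx) * (z + a * dz)
    = (1 - a) * (x * z) + a * (sigma * mu) + a * (a * (dx * dz)).
  transitivity (x * z + a * (z * dx + x * dz) + a * (a * (dx * dz))); first by ring.
  by rewrite row; ring.
have d1 : a * delta <= (1 - gamma) * smin / 2 * mu.
  by apply: le_trans ad; rewrite ler_pM2l// ler_norm.
have d2 : - ((1 - gamma) * smin / 2 * mu) <= a * (dx * dz).
  rewrite lerNl -mulrN; apply: le_trans axz; rewrite ler_pM2l// -normrN; exact: ler_norm.
have h1 : (1 - a) * (gamma * mu) <= (1 - a) * (x * z) by rewrite ler_wpM2l// subr_ge0.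
have h2 : a * (gamma * (a * delta)) <= a * (gamma * ((1 - gamma) * smin / 2 * mu)).
  by rewrite ler_pM2l// ler_pM2l.
have h3 : - (a * ((1 - gamma) * smin / 2 * mu)) <= a * (a * (dx * dz)).
  by rewrite -mulrN ler_pM2l.
have w0 : 0 < a * ((1 - gamma) * mu) by rewrite !mulr_gt0// subr_gt0.
have h4 : a * ((1 - gamma) * mu) * smin <= a * ((1 - gamma) * mu) * sigma.
  by rewrite ler_pM2l.
have h5 : gamma * (a * ((1 - gamma) * mu) * smin) <= a * ((1 - gamma) * mu) * smin.
  by rewrite ler_piMl ?ltW// mulr_gt0.
by rewrite expr2; lra.
Qed.

Section Step.
Context {R : realType} {m n : nat} {par : parameters R} {k : bounds R}
  {P : qp R m n} {y0 : 'cV[R]_m} {xs : 'cV[R]_n} {ys : 'cV[R]_m} {zs : 'cV[R]_n}.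
Context (H : bounded_qp par k P y0 xs ys zs).
Local Notation A := (qpA P).
Local Notation Q := (qpQ P).
Local Notation N := (n%:R : R).
Local Notation gamma := (gamma_mu par).
Local Notation kappa := (step_factor par k).

Lemma c_dir_ge0 : 0 <= c_dir par k.
Proof.
have [c50 _] := c_rhs_ge H; have := c_newton_ge0 H.
have := c_refx_ge0 H; have := c_refy_ge0 H.
by rewrite /c_dir; lra.
Qed.

Lemma c_start_ge0 : 0 <= c_start par k.
Proof.
have X0 := c_refx_ge0 H; have Y0 := c_refy_ge0 H; case: (bq_cst H) => _ uA uQ _ _.
by rewrite /c_start; apply: addr_ge0 => //; rewrite !addr_ge0 ?mulr_ge0.
Qed.

Lemma c_res_ge0 : 0 <= c_res par k.
Proof.
have := c_dir_ge0; have := c_start_ge0; have [c40 _ _] := c_iter_ge H => b0 c70.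
apply: addr_ge0; last by rewrite mulr_ge0.
by apply: mulr_ge0 => //; rewrite addr_ge0// divr_ge0 ?sqr_ge0.
Qed.

Lemma c_semi_gt0 : 0 < c_semi k.
Proof.
case: (bq_cst H) => lA _ uQ _ _; apply: ltr_wpDl => //.
by apply: mulr_ge0; [rewrite invr_ge0 ltW|rewrite addr_ge0].
Qed.

Lemma step_factorP : [/\ 0 < kappa <= 1,
  2 * (kappa * c_dir par k) <= (1 - gamma) * sigma_min par,
  kappa * (1 + c_dir par k / gamma) < 1,
  4 * (kappa * c_res par k) * rho par ^+ 2 <= C_N par * sigma_min par &
  4 * (kappa * c_res par k) * rho par ^+ 2 * c_semi k
    <= gamma_A par * rho par * sigma_min par].
Proof.
have c70 := c_dir_ge0; have c80 := c_res_ge0; have cs0 := c_semi_gt0.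
case: (bq_par H) => r0 CN0 /andP[gA0 _] /andP[g0 g1] [s0 _ _].
have g1' : 0 < 1 - gamma by rewrite subr_gt0.
rewrite /step_factor.
set L1 := 2 * c_dir par k / _; set L2 := 1 + c_dir par k / _.
set L3 := 4 * c_res par k * _ / _; set L4 := 4 * c_res par k * _ * _ / _.
have L10 : 0 <= L1 by rewrite divr_ge0 ?mulr_ge0// ltW.
have L20 : 0 <= L2 by rewrite addr_ge0// divr_ge0// ltW.
have L30 : 0 <= L3 by rewrite divr_ge0 ?mulr_ge0 ?sqr_ge0// ltW.
have L40 : 0 <= L4 by rewrite divr_ge0 ?mulr_ge0 ?sqr_ge0// ltW.
set L := 1 + L1 + L2 + L3 + L4.
have L0 : 0 < L by rewrite /L; lra.
have key v w : 0 < w -> v / w <= L -> L^-1 * v <= w.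
  by move=> w0; rewrite ler_pdivrMr// ler_pdivrMl.
split.
- by rewrite invr_gt0 L0 invf_le1// /L; lra.
- by rewrite mulrCA; apply: key; rewrite ?mulr_gt0// -/L1 /L; lra.
- by rewrite -/L2 mulrC ltr_pdivrMr// mul1r /L; lra.
- rewrite (_ : 4 * _ * _ = L^-1 * (4 * c_res par k * rho par ^+ 2)); last by ring.
  by apply: key; rewrite ?mulr_gt0// -/L3 /L; lra.
- rewrite (_ : 4 * _ * _ * _ = L^-1 * (4 * c_res par k * rho par ^+ 2 * c_semi k)).
    by apply: key; rewrite ?mulr_gt0// -/L4 /L; lra.
  by ring.
Qed.

(** A single term of the weighted sum is O(mu n^4), and mu is at most [x * z / gamma]. The bound,
    relative to x, is what keeps the step positive; it serves for z as well, with x and z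
    exchanged. *)
Lemma direction_entry (x z d : 'cV[R]_n) mu : 0 < mu ->
  (forall i, 0 < x i 0) -> (forall i, 0 < z i 0) ->
  (forall i, gamma * mu <= x i 0 * z i 0) ->
  \sum_i z i 0 / x i 0 * d i 0 ^+ 2 <= c_dir par k * mu * N ^+ 4 ->
  forall i, `|d i 0| <= (1 + c_dir par k / gamma) * (N ^+ 2 * x i 0).
Proof.
move=> mu0 x_gt0 z_gt0 gm sd i; have g0 := gamma_gt0 H; have c70 := c_dir_ge0.
apply: sqr_le_linear; rewrite ?divr_ge0 ?mulr_ge0 ?sqr_ge0 ?(ltW (x_gt0 i)) ?(ltW g0)//.
rewrite real_normK ?num_real//.
have di : z i 0 / x i 0 * d i 0 ^+ 2 <= c_dir par k * mu * N ^+ 4.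
  apply: le_trans sd; rewrite (bigD1 i)//= lerDl sumr_ge0// => j _.
  by rewrite mulr_ge0 ?sqr_ge0// divr_ge0 ?ltW.
rewrite -(ler_pM2l (divr_gt0 (z_gt0 i) (x_gt0 i))); apply: le_trans di _.
have -> : z i 0 / x i 0 * (c_dir par k / gamma * (N ^+ 2 * x i 0) ^+ 2)
   = c_dir par k * N ^+ 4 * (x i 0 * z i 0 / gamma).
  by field; rewrite !gt_eqF.
rewrite mulrAC; apply: ler_wpM2l; first by rewrite mulr_ge0// exprn_ge0.
by rewrite ler_pdivlMr// mulrC.
Qed.

(** Arithmetic-geometric mean in each coordinate: the weights z / x and x / z are inverse to each
    other. *)
Lemma direction_product (x z dx dz : 'cV[R]_n) B :
  (forall i, 0 < x i 0) -> (forall i, 0 < z i 0) ->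
  \sum_i z i 0 / x i 0 * dx i 0 ^+ 2 <= B ->
  \sum_i x i 0 / z i 0 * dz i 0 ^+ 2 <= B ->
  `|dot dx dz| <= B /\ forall i, `|dx i 0 * dz i 0| <= B.
Proof.
move=> x_gt0 z_gt0 sx sz.
have e i : `|dx i 0 * dz i 0|
    <= (z i 0 / x i 0 * dx i 0 ^+ 2 + x i 0 / z i 0 * dz i 0 ^+ 2) / 2.
  have xi := x_gt0 i; have zi := z_gt0 i.
  have r0 : 0 < z i 0 / x i 0 by rewrite divr_gt0.
  have : 0 <= z i 0 / x i 0 * (`|dx i 0| - x i 0 / z i 0 * `|dz i 0|) ^+ 2.
    by rewrite mulr_ge0 ?sqr_ge0// ltW.
  have -> : z i 0 / x i 0 * (`|dx i 0| - x i 0 / z i 0 * `|dz i 0|) ^+ 2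
    = z i 0 / x i 0 * `|dx i 0| ^+ 2 + x i 0 / z i 0 * `|dz i 0| ^+ 2
      - 2 * (`|dx i 0| * `|dz i 0|) by field; rewrite !gt_eqF.
  by rewrite normrM !real_normK ?num_real//; lra.
have s : \sum_i `|dx i 0 * dz i 0| <= B.
  apply: le_trans (ler_sum _ (fun i _ => e i)) _.
  by rewrite -mulr_suml big_split /=; lra.
split; first by apply: le_trans (ler_norm_sum _ _ _) s.
by move=> i; apply: le_trans s; rewrite (bigD1 i)//= lerDl sumr_ge0.
Qed.

(** The equations of the optimal solution turn the initial residuals into linear images of its
    difference from the starting point. *)
Lemma norm2_start : norm2 (bbar par P y0) <= c_start par k * N /\
  norm2 (cbar par P y0) <= c_start par k * N.
Proof.
have X0 := c_refx_ge0 H; have Y0 := c_refy_ge0 H; case: (bq_cst H) => lA uA uQ us uy.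
have r0 := rho_gt0 H.
have ref (w : 'cV[R]_n) : (forall i, `|w i 0| <= ub_opt k) ->
    norm2 (const_mx (rho par) - w : 'cV[R]_n) <= c_refx par k * N.
  move=> wu; apply: norm2_le_const => i; rewrite !mxE.
  apply: le_trans (ler_normB _ _) _; have := wu i.
  by rewrite (gtr0_norm r0) /c_refx; lra.
have nx := ref xs (bq_xs_le H); have nz := ref zs (bq_zs_le H).
have ny : norm2 (y0 - ys) <= c_refy par k * N.
  have := norm2B y0 ys; have := norm2_y0 H; have := norm2_ys H.
  have : 0 <= (lbA k)^-1 * (C_N par + ubQ k * rho par + rho par) * N.
    by rewrite mulr_ge0 ?(yshift_ge0 H).
  by rewrite /c_refy; lra.
have AX : ubA k * norm2 (const_mx (rho par) - xs) <= ubA k * (c_refx par k * N).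
  by rewrite ler_wpM2l.
have QX : ubQ k * norm2 (const_mx (rho par) - xs) <= ubQ k * (c_refx par k * N).
  by rewrite ler_wpM2l.
have AY : ubA k * norm2 (y0 - ys) <= ubA k * (c_refy par k * N) by rewrite ler_wpM2l.
have p1 : 0 <= ubQ k * c_refx par k * N by rewrite !mulr_ge0.
have p2 : 0 <= ubA k * c_refx par k * N by rewrite !mulr_ge0.
have p3 : 0 <= ubA k * c_refy par k * N by rewrite !mulr_ge0.
have p4 : 0 <= c_refx par k * N by rewrite mulr_ge0.
split.
  rewrite /bbar -(bq_primal H) /= -mulmxBr.
  by apply: le_trans (bq_ubA H _) _; rewrite /c_start; lra.
have -> : cbar par P y0 = - (Q *m (const_mx (rho par) - xs)) + A^T *m (y0 - ys)
    + (const_mx (rho par) - zs).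
  rewrite /cbar -(bq_dual H) /= !mulmxBr; apply/colP => i; rewrite !mxE; ring.
have := norm2D (- (Q *m (const_mx (rho par) - xs)) + A^T *m (y0 - ys))
  (const_mx (rho par) - zs).
have := norm2D (- (Q *m (const_mx (rho par) - xs))) (A^T *m (y0 - ys)).
rewrite norm2N; have := bq_ubQ H (const_mx (rho par) - xs).
by have := bq_ubAT H (y0 - ys); rewrite /c_start; lra.
Qed.

(** Size of the second-order remainder in [step_residual]: [u] is a proximal difference, [v] an
    initial residual and [w] a direction. *)
Lemma step_error p (u v w : 'cV[R]_p) mu delta s : 0 < mu ->
  norm2 u <= c_iter par k * N -> norm2 v <= c_start par k * N ->
  norm2 w <= c_dir par k * N ^+ 2 -> `|delta| * N <= c_dir par k * mu * N ^+ 4 ->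
  `|s| <= 2 * mu ->
  norm2 (delta *: (u - (rho par ^+ 2)^-1 *: v) + s *: w) <= c_res par k * mu * N ^+ 4.
Proof.
move=> mu0 nu nv nw dN s2; have N1 := N_ge1 H; have c70 := c_dir_ge0.
have r2 : 0 < rho par ^+ 2 by rewrite exprn_gt0// (rho_gt0 H).
have [c40 _ _] := c_iter_ge H; have b0 := c_start_ge0.
apply: le_trans (norm2D _ _) _; rewrite !norm2Z.
set e := c_iter par k + c_start par k / rho par ^+ 2.
have e0 : 0 <= e by rewrite addr_ge0// divr_ge0// ltW.
have uv : norm2 (u - (rho par ^+ 2)^-1 *: v) <= e * N.
  apply: le_trans (norm2B _ _) _; rewrite norm2Z ger0_norm ?invr_ge0 ?(ltW r2)//.
  by rewrite mulrDl lerD// [leRHS]mulrAC [leRHS]mulrC ler_pM2l ?invr_gt0.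
have h1 : `|delta| * norm2 (u - (rho par ^+ 2)^-1 *: v) <= e * (c_dir par k * mu * N ^+ 4).
  apply: (@le_trans _ _ (`|delta| * (e * N))); first by rewrite ler_wpM2l.
  by rewrite mulrCA ler_wpM2l.
have h2 : `|s| * norm2 w <= 2 * mu * (c_dir par k * N ^+ 4).
  apply: ler_pM; rewrite ?norm2_ge0//; apply: le_trans nw _.
  by rewrite ler_wpM2l// ler_weXn2l.
by rewrite /c_res -/e; lra.
Qed.

End Step.

(** * Effect of a step on mu and on the residuals *)

Lemma mu_of_step (R : realType) n (x z dx dz : 'cV[R]_n) a sigma : (0 < n)%N ->
  (forall i, z i 0 * dx i 0 + x i 0 * dz i 0
    = - (x i 0 * z i 0) + sigma * mu_of x z) ->
  mu_of (x + a *: dx) (z + a *: dz)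
  = (1 - a * (1 - sigma)) * mu_of x z + a ^+ 2 * (dot dx dz / n%:R).
Proof.
move=> n0 rows; have nn : n%:R != 0 :> R by rewrite pnatr_eq0 -lt0n.
have : dot z dx + dot x dz = - dot x z + n%:R * (sigma * mu_of x z).
  rewrite -big_split /= (eq_bigr _ (fun i _ => rows i)) big_split /= sumrN.
  by rewrite sumr_const card_ord -[_ *+ n]mulr_natl.
rewrite /mu_of !(dotDl, dotDr, dotZl, dotZr) (dotC dx z) => E.
apply: (mulIf nn); rewrite mulfVK// mulrDl.
have -> : dot x z + a * dot x dz + (a * dot z dx + a * (a * dot dx dz))
  = dot x z + a * (dot z dx + dot x dz) + a ^+ 2 * dot dx dz by ring.
by rewrite E; field.
Qed.

(* The proximal and the residual equations are affine in the step, except for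
   the second-order term of mu and for its product with the direction. *)
Lemma step_residual (R : realType) p (Ax Adx beta bt v d b : 'cV[R]_p)
    (mu r2 sigma a delta mua : R) : r2 != 0 ->
  Ax + mu *: v = b + (mu / r2) *: (beta + bt) ->
  Adx + mu *: d = (b + (sigma * mu / r2) *: beta) - Ax - (sigma * mu) *: v ->
  mua = (1 - a * (1 - sigma)) * mu + a ^+ 2 * delta ->
  Ax + a *: Adx + mua *: (v + a *: d)
  = b + (mua / r2) *: beta
    + (((1 - a) * (mu / r2)) *: bt
       + a ^+ 2 *: (delta *: (v - r2^-1 *: beta)
                    + (a * delta - (1 - sigma) * mu) *: d)).
Proof.
move=> r20 /colP E1 /colP E2 ->; apply/colP => i; have := E1 i; have := E2 i.
rewrite !mxE => e2 e1.
have -> : Adx i 0 = b i 0 + sigma * mu / r2 * beta i 0 - Ax i 0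
  - sigma * mu * v i 0 - mu * d i 0 by rewrite -e2; ring.
have -> : Ax i 0 = b i 0 + mu / r2 * (beta i 0 + bt i 0) - mu * v i 0.
  by rewrite -e1; ring.
by field.
Qed.

(** [K] is the allowed size of the perturbation, in either norm, and [E] bounds the second-order
    error. The old perturbation shrinks by [1 - a], whereas [mua] retains an extra
    [a * sigma * mu / 2], which pays for the error. *)
Lemma rescaled_perturbation_le (R : realType) (r2 mu mua a sigma smin K E : R) :
  0 < r2 -> 0 < mu -> 0 < a -> 0 < mua ->
  (1 - a) * mu + a * (sigma * mu / 2) <= mua -> smin <= sigma -> 0 <= K ->
  2 * r2 * (a * E) <= K * smin * mu ->
  r2 / mua * ((1 - a) * (mu / r2) * K + a ^+ 2 * E) <= K.
Proof.
move=> r20 mu0 a0 mua0 lo ss K0 aE.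
rewrite mulrAC ler_pdivrMr//.
have -> : r2 * ((1 - a) * (mu / r2) * K + a ^+ 2 * E)
    = (1 - a) * mu * K + a * (r2 * (a * E)) by field; rewrite gt_eqF.
have h1 : K * ((1 - a) * mu + a * (sigma * mu / 2)) <= K * mua by rewrite ler_wpM2l.
have h2 : K * (a * mu) * smin <= K * (a * mu) * sigma.
  by rewrite ler_wpM2l// mulr_ge0// mulr_ge0 ?ltW.
have h3 : a * (2 * r2 * (a * E)) <= a * (K * smin * mu) by rewrite ler_pM2l.
by lra.
Qed.

(** Gives the dual row the shape of the primal one, so that [step_residual] covers both; the
    opposite sign of the proximal term goes into the vectors. *)
Lemma newton_dual_row (R : realType) m n (A : 'M[R]_(m, n)) (Q : 'M[R]_n)
    (x z dx dz g v : 'cV_n) (y dy : 'cV_m) mu s :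
  - ((Q + mu%:M) *m dx) + A^T *m dy + dz
    = g + Q *m x - A^T *m y - z + s *: v ->
  (- (Q *m dx) + A^T *m dy + dz) + mu *: - dx
    = g - (- (Q *m x) + A^T *m y + z) - s *: - v.
Proof.
rewrite mulmxDl mul_scalar_mx => /colP E; apply/colP => i.
by have := E i; rewrite !mxE => e; lra.
Qed.

Lemma second_order_coef_le (R : realType) (mu a sigma smin delta : R) :
  0 < mu -> 0 < a -> 0 < smin -> smin <= sigma <= 2^-1 ->
  a * `|delta| <= smin / 2 * mu ->
  `|a * delta - (1 - sigma) * mu| <= 2 * mu.
Proof.
move=> mu0 a0 s0 /andP[ss s2] ad; apply: le_trans (ler_normB _ _) _.
have sm0 : 0 <= (1 - sigma) * mu by apply: mulr_ge0; [lra|exact: ltW].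
rewrite normrM (gtr0_norm a0) (ger0_norm sm0); apply: le_trans (lerD ad (lexx _)) _.
by rewrite -mulrDl ler_pM2r//; lra.
Qed.

(** * Admissibility of a step of order n^-4 *)

Section Admissible.
Context {R : realType} {m n : nat} {par : parameters R} {k : bounds R}
  {P : qp R m n} {y0 : 'cV[R]_m} {xs : 'cV[R]_n} {ys : 'cV[R]_m} {zs : 'cV[R]_n}.
Context (H : bounded_qp par k P y0 xs ys zs).
Local Notation A := (qpA P).
Local Notation Q := (qpQ P).
Local Notation N := (n%:R : R).
Local Notation gamma := (gamma_mu par).
Local Notation kappa := (step_factor par k).

Lemma step_positive (x d : 'cV[R]_n) a : 0 < a -> a * N ^+ 4 = kappa ->
  (forall i, 0 < x i 0) ->
  (forall i, `|d i 0| <= (1 + c_dir par k / gamma) * (N ^+ 2 * x i 0)) ->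
  forall i, 0 < (x + a *: d) i 0.
Proof.
move=> a0 aN x_gt0 dx i; have [_ _ k1 _ _] := step_factorP H.
have N1 := N_ge1 H; have g0 := gamma_gt0 H; have c70 := c_dir_ge0 H.
have xi := x_gt0 i; rewrite !mxE.
have dir0 : 0 <= 1 + c_dir par k / gamma by rewrite addr_ge0// divr_ge0// ltW.
have : a * `|d i 0| < x i 0.
  apply: (@le_lt_trans _ _ (kappa * (1 + c_dir par k / gamma) * x i 0)); last first.
    by rewrite gtr_pMl.
  rewrite -aN [leRHS](_ : _ = a * ((1 + c_dir par k / gamma) * (N ^+ 4 * x i 0))).
    rewrite ler_pM2l//; apply: le_trans (dx i) _; apply: ler_wpM2l => //.
    by rewrite ler_pM2r// ler_weXn2l.
  by ring.
have := ler_norm (- d i 0); rewrite normrN => dn.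
have : a * - d i 0 <= a * `|d i 0| by rewrite ler_pM2l.
by lra.
Qed.

Lemma step_admissible zeta lambda x y z sigma dx dy dz :
  let mu := mu_of x z in
  neighbourhood par P y0 mu zeta lambda x y z -> mu <= rho par ^+ 2 ->
  norm2 (x - zeta) <= c_iter par k * N -> norm2 (y - lambda) <= c_iter par k * N ->
  sigma_min par <= sigma <= sigma_max par ->
  newton_direction par P y0 (Iterate x y z zeta lambda) sigma dx dy dz ->
  \sum_i z i 0 / x i 0 * dx i 0 ^+ 2 <= c_dir par k * mu * N ^+ 4 ->
  \sum_i x i 0 / z i 0 * dz i 0 ^+ 2 <= c_dir par k * mu * N ^+ 4 ->
  norm2 dx <= c_dir par k * N ^+ 2 -> norm2 dy <= c_dir par k * N ^+ 2 ->
  admissible_step par P y0 (Iterate x y z zeta lambda) dx dy dz (kappa / N ^+ 4).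
Proof.
move=> mu nb mu_le nxz nyl /andP[ss sM] nd sdx sdz ndx ndy.
have [x_gt0 z_gt0 gm [bt [ct [nbc sbc Ex Ez]]]] := nb.
have mu_gt0 : 0 < mu by exact: (mu_of_gt0 H).
rewrite -/mu in gm Ex Ez.
have r0 := rho_gt0 H; have r2 : 0 < rho par ^+ 2 by rewrite exprn_gt0.
have g0 := gamma_gt0 H; have g01 := gamma_mu01 H; have [_ g1] := andP g01.
have N1 := N_ge1 H; have Np : 0 < N by apply: lt_le_trans N1.
have c70 := c_dir_ge0 H; have c80 := c_res_ge0 H; have cs0 := c_semi_gt0 H.
have [/andP[k0 k1] kc7 _ kCN kgA] := step_factorP H.
case: (bq_par H) => _ CN0 /andP[gA0 _] _ [s0 _ s2].
have s01 : sigma <= 2^-1 by apply: le_trans sM s2.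
set a := kappa / N ^+ 4.
have a0 : 0 < a by rewrite divr_gt0// exprn_gt0.
have aN : a * N ^+ 4 = kappa by rewrite divfK// gt_eqF// exprn_gt0.
have a1 : a <= 1.
  by rewrite ler_pdivrMr ?exprn_gt0// mul1r (le_trans k1)// exprn_ege1.
clearbody a.
have [dB dBi] := direction_product x_gt0 z_gt0 sdx sdz.
pose B := c_dir par k * mu * N ^+ 4; rewrite -/B in dB dBi.
have aB : a * B <= (1 - gamma) * sigma_min par / 2 * mu.
  rewrite (_ : a * B = kappa * c_dir par k * mu); last by rewrite -aN /B; ring.
  by rewrite ler_pM2r//; lra.
have gs : (1 - gamma) * sigma_min par <= sigma_min par by rewrite ler_piMl ?ltW//; lra.
pose delta := dot dx dz / N.
have dN : `|delta| * N <= B.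
  by rewrite /delta normrM normfV (gtr0_norm Np) divfK// gt_eqF.
have dB' : `|delta| <= B by apply: le_trans dN; rewrite ler_peMr.
have ad : a * `|delta| <= (1 - gamma) * sigma_min par / 2 * mu.
  by apply: le_trans aB; rewrite ler_pM2l.
have ad' : a * `|delta| <= sigma_min par / 2 * mu.
  by apply: le_trans ad _; rewrite ler_pM2r//; lra.
have rows := newton_direction_rows nd.
have muaE := mu_of_step a (n_gt0 H) rows.
rewrite -/mu -/delta in muaE rows.
rewrite /admissible_step /=; set mua := mu_of _ _ in muaE *.
have ssig : sigma_min par <= sigma <= 2^-1 by rewrite ss.
have /andP[lo up] := step_mu_bounds mu_gt0 a0 ssig ad' muaE.
have mua0 : 0 < mua.
  apply: lt_le_trans lo; apply: ltr_wpDl; first by rewrite mulr_ge0 ?subr_ge0// ltW.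
  by rewrite mulr_gt0// divr_gt0// mulr_gt0// (lt_le_trans s0).
have gm' i : gamma * mu <= z i 0 * x i 0 by rewrite [leRHS]mulrC.
split=> //; first by rewrite a0.
split.
- exact: step_positive a0 aN x_gt0 (direction_entry H mu_gt0 x_gt0 z_gt0 gm sdx).
- exact: step_positive a0 aN z_gt0 (direction_entry H mu_gt0 z_gt0 x_gt0 gm' sdz).
- move=> i; rewrite !mxE; apply: (step_centrality (smin := sigma_min par)
    (sigma := sigma) mu_gt0 _ g01 _ ad _ muaE (gm i) (rows i)).
  + by rewrite a0.
  + by rewrite s0.
  + by apply: le_trans aB; rewrite ler_pM2l.
have [N1' N2' _] := nd; move: N1' N2'.
rewrite mu0E ?(n_gt0 H)// /Defs.mu /= -/mu => N1' N2'.
rewrite mu0E ?(n_gt0 H)// in Ex Ez *.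
have r2n : rho par ^+ 2 != 0 by rewrite gt_eqF.
have Ep := step_residual r2n Ex N2' muaE.
have Ez' : (- (Q *m x) + A^T *m y + z) + mu *: - (x - zeta)
  = qpc P + (mu / rho par ^+ 2) *: (cbar par P y0 + ct) by rewrite scalerN.
have Ed := step_residual r2n Ez' (newton_dual_row N1') muaE.
set ep := delta *: _ + _ in Ep; set ed := delta *: _ + _ in Ed.
have [nb0 nc0] := norm2_start H.
have s_le : `|a * delta - (1 - sigma) * mu| <= 2 * mu.
  exact: second_order_coef_le s0 ssig ad'.
have nep : norm2 ep <= c_res par k * mu * N ^+ 4 by exact: (step_error H).
have ned : norm2 ed <= c_res par k * mu * N ^+ 4.
  by apply: (step_error H); rewrite ?norm2N.
clearbody ep ed.
(* [g] is the coefficient of the old perturbation in the new residual; [f] undoes the factor mua /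
   mu0 by which the neighbourhood scales perturbations. *)
pose f := rho par ^+ 2 / mua; pose g := (1 - a) * (mu / rho par ^+ 2).
have f0 : 0 <= f by rewrite divr_ge0 ?ltW.
have g0' : 0 <= g by apply: mulr_ge0; [rewrite subr_ge0|rewrite divr_ge0 ?ltW].
have fE : mua / rho par ^+ 2 * f = 1 by rewrite /f; field; rewrite !gt_eqF.
have resid p (b u v : 'cV[R]_p) :
    b + (mua / rho par ^+ 2) *: (u + f *: v) = b + (mua / rho par ^+ 2) *: u + v.
  by rewrite scalerDr scalerA fE scale1r addrA.
rewrite -/g in Ep Ed.
exists (f *: (g *: bt + a ^+ 2 *: ep)), (f *: (g *: ct + a ^+ 2 *: ed)).
have sum_le : norm2 ep + norm2 ed <= 2 * (c_res par k * mu * N ^+ 4) by lra.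
split.
- rewrite -scale_col_mx -add_col_mx -!scale_col_mx norm2Z ger0_norm//.
  apply: le_trans (rescaled_perturbation_le (E := 2 * (c_res par k * mu * N ^+ 4))
    r2 mu_gt0 a0 mua0 lo ss (ltW CN0) _).
    apply: ler_wpM2l => //; apply: le_trans (norm2D _ _) _.
    rewrite !norm2Z (ger0_norm g0') (ger0_norm (sqr_ge0 a)); apply: lerD.
      by rewrite ler_wpM2l.
    by rewrite ler_wpM2l ?sqr_ge0//; apply: le_trans (norm2_col_mx_le _ _) _.
  rewrite (_ : _ * (a * _) = 4 * (kappa * c_res par k) * rho par ^+ 2 * mu).
    by rewrite ler_pM2r.
  by rewrite -aN; ring.
- case: (bq_cst H) => lA _ uQ _ _.
  apply: le_trans (seminormZ lA (bq_lbA H) _ _ f0) _.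
  apply: le_trans (rescaled_perturbation_le
    (E := c_semi k * (2 * (c_res par k * mu * N ^+ 4)))
    r2 mu_gt0 a0 mua0 lo ss (ltW (mulr_gt0 gA0 r0)) _).
    apply: ler_wpM2l => //; apply: le_trans (seminormD lA (bq_lbA H) _ _ _ _) _.
    apply: lerD.
      apply: le_trans (seminormZ lA (bq_lbA H) _ _ g0') _.
      by rewrite ler_wpM2l.
    apply: le_trans (seminormZ lA (bq_lbA H) _ _ (sqr_ge0 a)) _.
    rewrite ler_wpM2l ?sqr_ge0//.
    apply: le_trans (seminorm_le_norm2 lA (bq_lbA H) uQ (bq_ubQ H) _ _) _.
    by rewrite ler_wpM2l// ltW.
  rewrite (_ : _ * (a * _) =
    4 * (kappa * c_res par k) * rho par ^+ 2 * c_semi k * mu).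
    by rewrite ler_pM2r.
  by rewrite -aN; ring.
- by rewrite resid -Ep addrAC mulmxDr -scalemxAr.
- rewrite resid -Ed !mulmxDr -!scalemxAr.
  by apply/colP => i; rewrite !mxE; ring.
Qed.

End Admissible.

(** * Convergence *)

Section Run.
Context {R : realType} {m n : nat} {par : parameters R} {k : bounds R}
  {P : qp R m n} {y0 : 'cV[R]_m} {xs : 'cV[R]_n} {ys : 'cV[R]_m} {zs : 'cV[R]_n}.
Context (H : bounded_qp par k P y0 xs ys zs).
Local Notation A := (qpA P).
Local Notation Q := (qpQ P).
Local Notation N := (n%:R : R).
Local Notation kappa := (step_factor par k).

(** The bounds on the proximal points are part of the invariant because [iterate_bound] relies on
    them at every iteration. *)
Definition run_invariant (w : iterate R m n) : Prop :=
  [/\ neighbourhood par P y0 (mu w) (it_zeta w) (it_lambda w)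
        (it_x w) (it_y w) (it_z w),
      mu w <= rho par ^+ 2,
      norm2 (it_zeta w) <= c_prox par k * N &
      norm2 (it_lambda w) <= c_prox par k * N].

Lemma run_invariant_start : run_invariant (start (n := n) par y0).
Proof.
have r0 := rho_gt0 H; have r2 : 0 < rho par ^+ 2 by rewrite exprn_gt0.
have muE : mu (start (n := n) par y0) = rho par ^+ 2 := mu0E par y0 (n_gt0 H).
have nb : neighbourhood par P y0 (mu (start (n := n) par y0)) (const_mx (rho par)) y0
    (const_mx (rho par)) y0 (const_mx (rho par)).
  split; [by move=> i; rewrite mxE | by move=> i; rewrite mxE | |].
    move=> i; rewrite muE !mxE -expr2 ler_piMl ?ltW//.
    by case/andP: (gamma_mu01 H).
  (* At the start mu = mu0, so the residuals are exactly [bbar] and [cbar] and the perturbation is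
     zero. *)
  exists 0, 0; rewrite mu0E ?(n_gt0 H)// muE divff ?gt_eqF// !scale1r.
  case: (bq_par H) => _ CN0 /andP[gA0 _] _ _; split.
  - by rewrite col_mx0 norm20 ltW.
  - apply: (@le_trans _ _ 0); last by rewrite mulr_ge0 ?ltW.
    rewrite -[leRHS](@norm20 _ (n + n)) -col_mx0.
    by apply: (@seminorm_le _ _ _ _ _ _ _ 0); rewrite !mulmx0 ?oppr0 ?addr0.
  - by rewrite subrr scaler0 /bbar /=; apply/colP => i; rewrite !mxE; ring.
  - by rewrite subrr scaler0 /cbar /=; apply/colP => i; rewrite !mxE; ring.
have mu_le : mu (start (n := n) par y0) <= rho par ^+ 2 by rewrite muE.
by have [? ?] := proximal_bound H nb mu_le; split.
Qed.

(** The step length is the largest admissible one, hence at least [kappa / N ^+ 4], and its own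
    admissibility gives the decrease and the neighbourhood. *)
Lemma run_invariant_step w w' : run_invariant w -> ippmm_step par P y0 w w' ->
  run_invariant w' /\ mu w' <= (1 - kappa / N ^+ 4 / 100) * mu w.
Proof.
case: w => x y z zeta lambda [/=]; rewrite /mu /= => nb mu_le nzeta nlambda.
move=> [sigma [dx [dy [dz [alpha [ss nd [adm amax] [Ex Ey Ez] [upd noupd]]]]]]].
have [nxz nyl sx sz] := iterate_bound H nb mu_le nzeta nlambda.
case: (bq_par H) => r0 CN0 /andP[gA0 _] _ [s0 _ s2].
have s01 : 0 <= sigma <= 1 by case/andP: ss => h1 h2; apply/andP; split; lra.
have [sdx sdz ndx ndy] := newton_bound H nb mu_le nxz nyl sx sz s01 nd.
have /amax a_ge := step_admissible H nb mu_le nxz nyl ss nd sdx sdz ndx ndy.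
have [x_gt0 z_gt0 _ _] := nb; have mu_gt0 : 0 < mu_of x z := mu_of_gt0 H x_gt0 z_gt0.
have [/andP[a0 a1]] := adm; rewrite /= -Ex -Ey -Ez => mu'_le nb'.
have mu'_rho : mu_of (it_x w') (it_z w') <= rho par ^+ 2.
  apply: le_trans mu_le; apply: le_trans mu'_le _.
  by rewrite /mu /= ler_piMl ?(ltW mu_gt0)//; lra.
have [x'_gt0 z'_gt0 x'z' _] := nb'.
have mu'_gt0 := mu_of_gt0 H x'_gt0 z'_gt0.
have r2 : 0 < rho par ^+ 2 by rewrite exprn_gt0.
split; last first.
  apply: le_trans mu'_le _; rewrite /mu /= ler_pM2r//.
  by rewrite lerD2l lerN2 ler_pM2r// invr_gt0 ltr0n.
(* If the test succeeds, the new iterate lies in the neighbourhood centred at itself, the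
   perturbation being the rescaled residuals, and [proximal_bound] applies to the new proximal
   points. Otherwise the old ones are kept. *)
have [test|test] := pselect (update_test par P y0 (it_x w') (it_y w') (it_z w')).
  have [zeta' lambda'] := upd test.
  suff nb'' : neighbourhood par P y0 (mu_of (it_x w') (it_z w')) (it_x w') (it_y w')
      (it_x w') (it_y w') (it_z w').
    by have [nx ny] := proximal_bound H nb'' mu'_rho; split; rewrite ?zeta' ?lambda'.
  split=> //; move: test; rewrite /update_test mu0E ?(n_gt0 H)//.
  set mu' := mu_of _ _ in mu'_gt0 *.
  move=> [nr sr]; set rp := _ - _ in nr sr; set rd := _ + _ - _ in nr sr.
  pose f := rho par ^+ 2 / mu'.
  have f0 : 0 <= f by rewrite divr_ge0 ?ltW.
  have fE : mu' / rho par ^+ 2 * f = 1 by rewrite /f; field; rewrite !gt_eqF.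
  exists (f *: rp), (f *: rd); split.
  - rewrite -scale_col_mx norm2Z ger0_norm//.
    apply: le_trans (ler_wpM2l f0 nr) _.
    by rewrite mulrCA mulrC [f * _]mulrC fE mul1r.
  - apply: le_trans (seminormZ (let: And5 l _ _ _ _ := bq_cst H in l) (bq_lbA H) _ _ f0) _.
    apply: le_trans (ler_wpM2l f0 sr) _.
    by rewrite mulrCA mulrC [f * _]mulrC fE mul1r.
  - rewrite subrr scaler0 scalerDr scalerA fE scale1r /rp.
    by apply/colP => i; rewrite !mxE; ring.
  - rewrite subrr scaler0 scalerDr scalerA fE scale1r /rd.
    by apply/colP => i; rewrite !mxE; ring.
by have [zeta' lambda'] := noupd test; split; rewrite ?zeta' ?lambda'.
Qed.

Lemma mu_decrease w : ippmm_run par P y0 w -> forall i,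
  mu (w i) <= (1 - kappa / N ^+ 4 / 100) ^+ i * rho par ^+ 2.
Proof.
move=> [w0 ws] i; suff [] : run_invariant (w i) /\
  mu (w i) <= (1 - kappa / N ^+ 4 / 100) ^+ i * rho par ^+ 2 by [].
have [/andP[k0 k1] _ _ _ _] := step_factorP H.
have N1 : 1 <= N ^+ 4 by rewrite exprn_ege1// (N_ge1 H).
have q0 : 0 <= 1 - kappa / N ^+ 4 / 100.
  have : kappa / N ^+ 4 <= 1.
    by rewrite ler_pdivrMr ?mul1r ?(lt_le_trans _ N1)// (le_trans k1).
  by lra.
elim: i => [|i [inv mui]].
  rewrite w0; have inv := run_invariant_start; split=> //.
  by rewrite expr0 mul1r; case: inv.
have [inv' muS] := run_invariant_step inv (ws i); split=> //.
by apply: le_trans muS _; rewrite [_ ^+ i.+1]exprS -[leRHS]mulrA ler_wpM2l.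
Qed.

End Run.

(** (1 - q)^i <= exp(-q i), so any i at least [(|ln r| + ln (1 / eps)) / q] will do; rounding this
    up to an integer costs the final 1. *)
Lemma geometric_log_bound (R : realType) (q r eps : R) (u : nat -> R) :
  0 < q <= 1 -> 0 < r -> 0 < eps < 1 -> (forall i, u i <= (1 - q) ^+ i * r) ->
  exists K : nat, K%:R <= (`|ln r| + ln (1 / eps)) / q + 1 /\
    forall i, (K <= i)%N -> u i <= eps.
Proof.
move=> /andP[q0 q1] r0 /andP[e0 e1] ur.
have l0 : 0 <= ln (1 / eps) by rewrite ln_ge0// div1r invf_ge1// ltW.
set v := _ / q; have v0 : 0 <= v by rewrite divr_ge0 ?addr_ge0// ltW.
have /andP[tv vt] := truncn_itv v0.
exists (Num.truncn v).+1; split; first by rewrite -natr1 lerD2r.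
move=> i Ki; apply: le_trans (ur i) _.
have vi : v <= i%:R by apply: ltW; apply: lt_le_trans vt _; rewrite ler_nat.
have h : (1 - q) ^+ i <= expR (- (q * i%:R)).
  rewrite -mulNr mulrC expRM_natl lerXn2r ?nnegrE ?expR_ge0 ?subr_ge0//.
  exact: expR_ge1Dx.
have qv : `|ln r| + ln (1 / eps) <= q * i%:R.
  by rewrite -[leLHS](divfK (lt0r_neq0 q0)) mulrC ler_pM2l.
apply: (@le_trans _ _ (expR (- (q * i%:R)) * r)); first by rewrite ler_pM2r.
rewrite -{1}(lnK (x := r)) ?posrE// -expRD -[leRHS](lnK (x := eps)) ?posrE// ler_expR.
move: qv; rewrite div1r lnV ?posrE//; have := ler_norm (ln r); lra.
Qed.

Theorem theorem3p8 (R : realType) (par : parameters R)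
  (Cstar CA1 CA2 CQ Cr Cy C omega epsbar : R)
  (hpar : valid_parameters par)
  (hCstar : 0 <= Cstar) (hCA1 : 0 < CA1) (hCA2 : 0 < CA2) (hCQ : 0 < CQ)
  (hCr : 0 < Cr) (hC : 0 < C) (homega : 0 < omega)
  (hepsbar : 0 < epsbar < 1) :
  exists (M : R) (N : nat),
  forall (eps : R) (m n : nat) (P : qp R m n) (y0 : 'cV[R]_m)
    (w : nat -> iterate R m n),
  0 < eps <= epsbar ->
  (0 < m <= n)%N ->
  sym_psd (qpQ P) ->
  (exists (x : 'cV[R]_n) (y : 'cV[R]_m) (z : 'cV[R]_n),
     optimal_solution P x y z /\
     [/\ `|x| <= Cstar, `|y| <= Cstar & `|z| <= Cstar]) ->
  \rank (qpA P) = m ->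
  CA1 <= eta_min (qpA P) ->
  eta_max (qpA P) <= CA2 ->
  nu_max (qpQ P) <= CQ ->
  `|col_mx (qpc P) (qpb P)| <= Cr ->
  `|y0| <= Cy ->
  mu0 (n := n) par y0 <= C / eps `^ omega ->
  ippmm_run par P y0 w ->
  exists K : nat,
    ((N <= n)%N -> K%:R <= M * (n%:R ^+ 4 * `|ln (1 / eps)|)) /\
    (forall k : nat, (K <= k)%N -> mu (w k) <= eps).
Proof.
pose k := Bounds CA1 CA2 CQ Cstar Cy; pose r := rho par ^+ 2.
pose L := ln (1 / epsbar); pose kappa := step_factor par k.
(* As [eps <= epsbar < 1], [ln (1 / eps)] is at least [L > 0], so the additive terms [|ln r|] and 1
   of the iteration count are at most [|ln r| / L] and [L^-1] times this logarithm. The factor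
   [100 / kappa] comes from inverting the rate, and the bound holds for every n, whence the
   threshold 0. *)
exists ((`|ln r| / L + 1) * (100 / kappa) + L^-1), 0%N.
move=> eps m n P y0 w /andP[e0 e1] mn Qpsd [xs [ys [zs [opt [xsC ysC zsC]]]]] _.
move=> etaA etaA' nuQ _ y0C _ run.
have [m0 le_mn] := andP mn; have n0 : (0 < n)%N by exact: leq_trans le_mn.
case/andP: hepsbar => eb0 eb1.
have [[Axs xs0] _ [zsE zs0] _] := opt.
have AT_le y : norm2 ((qpA P)^T *m y) <= CA2 * norm2 y.
  by apply: le_trans (norm2_trmx_le _ _ m0) _; rewrite ler_wpM2r ?norm2_ge0.
have entry p (u : 'cV[R]_p) c : `|u| <= c -> forall i, `|u i 0| <= c.
  by move=> uc i; apply: le_trans uc; exact: entry_le_norm.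
have H : bounded_qp par k P y0 xs ys zs.
  split=> //=; try exact: entry.
  - by split=> //=; [exact: ltW|exact: ltW|exact: le_trans y0C].
  - move=> y; apply: le_trans (eta_min_le _ _ m0).
    by rewrite ler_wpM2r ?norm2_ge0.
  - by move=> x; apply: norm2_mulmx_le => //; exact: ltW.
  - move=> x; apply: norm2_psd_le => //; first exact: ltW.
    move=> v; apply: le_trans (nu_max_ge _ n0 Qpsd.1) _.
    by rewrite ler_wpM2r ?dot_ge0.
  - exact: optimal_complementary opt.
have [/andP[k0 k1] _ _ _ _] := step_factorP H; rewrite -/kappa in k0 k1.
have N1 : 1 <= (n%:R : R) ^+ 4 by rewrite exprn_ege1// ler1n.
have N0 : 0 < (n%:R : R) ^+ 4 by apply: lt_le_trans N1.
have r0 : 0 < r by rewrite exprn_gt0// (rho_gt0 H).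
have q01 : 0 < kappa / n%:R ^+ 4 / 100 <= 1.
  rewrite divr_gt0// ?divr_gt0//= ler_pdivrMr// mul1r ler_pdivrMr//.
  by apply: le_trans k1 _; rewrite mulr_ege1 ?ler1n.
have e01 : 0 < eps < 1 by rewrite e0 (le_lt_trans e1).
have [K [K_le K_mu]] := geometric_log_bound q01 r0 e01 (mu_decrease H run).
exists K; split=> // _; apply: le_trans K_le _.
have L0 : 0 < L by rewrite ln_gt0// div1r invf_gt1.
have lL : L <= ln (1 / eps).
  by rewrite ler_ln ?posrE ?divr_gt0// ler_pM2l// lef_pV2.
have l0 : 0 < ln (1 / eps) by apply: lt_le_trans lL.
rewrite (gtr0_norm l0); move: (ln (1 / eps)) l0 lL => l l0 lL.
have lL1 : 1 <= l / L by rewrite ler_pdivlMr// mul1r.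
have h1 : `|ln r| <= `|ln r| / L * l by rewrite -mulrA [_^-1 * l]mulrC ler_peMr.
have h2 : 1 <= L^-1 * (n%:R ^+ 4 * l).
  by rewrite mulrCA [_^-1 * l]mulrC mulr_ege1.
have h3 : (`|ln r| + l) / (kappa / n%:R ^+ 4 / 100)
    <= (`|ln r| / L * l + l) * (100 / kappa * n%:R ^+ 4).
  rewrite (_ : (kappa / _ / _)^-1 = 100 / kappa * n%:R ^+ 4); last first.
    by field; rewrite (gt_eqF k0) pnatr_eq0 -lt0n n0.
  by rewrite ler_wpM2r ?lerD// mulr_ge0 ?divr_ge0 ?ltW.
by lra.
Qed.
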